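(* Let $R$ be a commutative Noetherian ring, $N$ a finitely generated $R$-module, $\mathfrak a$ an ideal of $R$ with $N\neq\mathfrak aN$ and $n:=\operatorname{depth}_R(\mathfrak a,N)$. Then $$\operatorname{Ann}_R(N/\mathrm S(\mathfrak a,N))\subseteq\operatorname{Ann}_R(H^n_{\mathfrak a}(N))\subseteq\operatorname{Ann}_R\Big(N/\bigcap_{\mathfrak p\in\Sigma}C^N_{\mathfrak p}(0)\Big)\cap\Big(\bigcap_{\mathfrak p\in\Sigma'}\mathfrak p\Big),$$ where $\Sigma:=\{\mathfrak p\in\operatorname{MinAss}_R(N):\operatorname{ht}_{R/\mathfrak p}((\mathfrak a+\mathfrak p)/\mathfrak p)=n\}$ and $\Sigma':=\{\mathfrak p\in\operatorname{Ass}_R(N)\setminus\operatorname{MinAss}_R(N):\operatorname{ht}_{R/\mathfrak p}((\mathfrak a+\mathfrak p)/\mathfrak p)=n\}$.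
   Context: $R$ is a commutative Noetherian ring with non-zero identity; $H^i_{\mathfrak a}(N)$ is the $i$-th local cohomology module. $\operatorname{depth}_R(\mathfrak a,N):=\inf\{i\ge0:H^i_{\mathfrak a}(N)\ne0\}$, finite when $N\neq\mathfrak aN$. $\operatorname{MinAss}_R(N)$ is the set of minimal elements of $\operatorname{Ass}_R(N)$. For $\mathfrak p\in\operatorname{Supp}_R(N)$, $C^N_{\mathfrak p}(0)$ is the kernel of the canonical map $N\to N_{\mathfrak p}$. $\mathrm S(\mathfrak a,N):=\bigcap_{\mathfrak p\in\operatorname{Ass}_R(N),\ \mathfrak a+\mathfrak p\ne R}C^N_{\mathfrak p}(0)$, which is the largest submodule $L$ of $N$ such that $L=\mathfrak aL$. $\operatorname{ht}_{R/\mathfrak p}((\mathfrak a+\mathfrak p)/\mathfrak p)$ is the height of the ideal $(\mathfrak a+\mathfrak p)/\mathfrak p$ in the ring $R/\mathfrak p$, equal to $\infty$ when $\mathfrak a+\mathfrak p=R$. Convention: an empty intersection of submodules of $N$ is $N$, and an empty intersection of ideals of $R$ is $R$. *)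

(* Defs.v *)
From HB Require Import structures.
From mathcomp Require Import all_boot all_order all_algebra.
From mathcomp Require Import generic_quotient ring_quotient.
From mathcomp Require Import boolp classical_sets.
From mathcomp Require Import ring.

Set Implicit Arguments.
Unset Strict Implicit.
Unset Printing Implicit Defensive.

Import GRing.Theory.

Local Open Scope classical_set_scope.
Local Open Scope quotient_scope.
Local Open Scope ring_scope.

(* Extended naturals, with [None] for infinity. *)

Definition enat := option nat.

Definition enat_inf (P : set nat) : enat :=
  if pselect (exists n, `[< P n >]) is left exP then Some (ex_minn exP)
  else None.

(* Least upper bound, i.e. the infimum of the set of upper bounds. *)
Definition enat_sup (P : set nat) : enat :=
  enat_inf [set n | forall m, P m -> (m <= n)%N].

(* Submodules of [M] are the [L : submodClosed M], and ideals of [R] (possibly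
   equal to [R]) are the submodules of [R^o]. Prime ideals are the
   [p : prime_idealr R]. *)

Notation ideal R := (submodClosed R^o).

Definition topm (R : comNzRingType) (M : lmodType R) : {pred M} := predT.
Arguments topm {R} M _.

Definition zerom (R : comNzRingType) (M : lmodType R) : {pred M} := pred1 0.
Arguments zerom {R} M _.

Section Submodules.
Variable R : comNzRingType.
Implicit Types M : lmodType R.

Lemma topm_closed M : submod_closed (topm M).
Proof. by []. Qed.
HB.instance Definition _ M := GRing.isSubmodClosed.Build R M (topm M)
  (topm_closed M).

Lemma zerom_closed M : submod_closed (zerom M).
Proof.
split=> [|a x y]; rewrite !unfold_in //.
by move=> /eqP-> /eqP->; rewrite scaler0 addr0.
Qed.
HB.instance Definition _ M := GRing.isSubmodClosed.Build R M (zerom M)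
  (zerom_closed M).

Definition kerm M M' (f : {linear M -> M'}) : {pred M} := fun x => f x == 0.

Lemma kerm_closed M M' (f : {linear M -> M'}) : submod_closed (kerm f).
Proof.
split=> [|a x y]; rewrite !unfold_in ?linear0 // => /eqP fx /eqP fy.
by rewrite linearP fx fy scaler0 addr0.
Qed.
HB.instance Definition _ M M' (f : {linear M -> M'}) :=
  GRing.isSubmodClosed.Build R M (kerm f) (kerm_closed f).

Definition imm M M' (f : {linear M -> M'}) : {pred M'} :=
  fun y => `[< exists x, y = f x >].

Lemma imm_closed M M' (f : {linear M -> M'}) : submod_closed (imm f).
Proof.
split=> [|a u v]; first by apply/asboolP; exists 0; rewrite linear0.
move=> /asboolP[x ->] /asboolP[y ->]; apply/asboolP.
by exists (a *: x + y); rewrite linearP.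
Qed.
HB.instance Definition _ M M' (f : {linear M -> M'}) :=
  GRing.isSubmodClosed.Build R M' (imm f) (imm_closed f).

Definition bigcapm M (I : Type) (D : I -> Prop) (F : I -> submodClosed M) :
    {pred M} :=
  fun x => `[< forall i, D i -> x \in F i >].

Lemma bigcapm_closed M I (D : I -> Prop) (F : I -> submodClosed M) :
  submod_closed (bigcapm D F).
Proof.
split=> [|a x y]; first by apply/asboolP => i _; rewrite rpred0.
move=> /asboolP xF /asboolP yF; apply/asboolP => i Di.
by rewrite rpredD ?rpredZ ?xF ?yF.
Qed.
HB.instance Definition _ M I (D : I -> Prop) (F : I -> submodClosed M) :=
  GRing.isSubmodClosed.Build R M (bigcapm D F) (bigcapm_closed D F).

Definition submodule M (L : submodClosed M) : Type := {x : M | x \in L}.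

HB.instance Definition _ M (L : submodClosed M) := SubChoice.on (submodule L).
HB.instance Definition _ M (L : submodClosed M) :=
  [SubChoice_isSubLmodule of submodule L by <:].

(* [L :&: K], as a submodule of [K]. *)
Definition restrm M (K L : submodClosed M) : {pred submodule K} :=
  fun x => val x \in L.
Arguments restrm {M} K L _.

Lemma restrm_closed M (K L : submodClosed M) : submod_closed (restrm K L).
Proof.
split=> [|a x y xL yL].
  by change (val (0 : submodule K) \in L); rewrite raddf0 rpred0.
change (val (a *: x + y) \in L).
by rewrite linearP rpredD //; exact: (@rpredZ R M L a (val x) xL).
Qed.
HB.instance Definition _ M (K L : submodClosed M) :=
  GRing.isSubmodClosed.Build R (submodule K) (restrm K L) (restrm_closed K L).

Section QuotientModule.
Variables (M : lmodType R) (L : submodClosed M).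

(* A [submodClosed] predicate is not canonically a [zmodClosed] one. *)
Definition submod_zpred : {pred M} := L.
HB.instance Definition _ := GRing.isZmodClosed.Build M submod_zpred
  (GRing.submod_closedB (submodClosedP L)).

Definition quotient_module : Type := Quotient.quot submod_zpred.
Local Notation Q := (Quotient.quot submod_zpred).
HB.instance Definition _ := GRing.Zmodule.on quotient_module.

Definition quotient_scale (r : R) (x : quotient_module) : quotient_module :=
  \pi_(Q) (r *: repr (x : Q)).

Lemma quotient_scaleE r (x : M) :
  quotient_scale r (\pi_(Q) x) = \pi_(Q) (r *: x).
Proof.
apply/eqP; rewrite -Quotient.idealrBE -scalerBr.
rewrite -[_ \in _]/(_ \in L) rpredZ // -[_ \in _]/(_ \in submod_zpred).
by rewrite Quotient.idealrBE reprK.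
Qed.

Fact quotient_scaleA a b x :
  quotient_scale a (quotient_scale b x) = quotient_scale (a * b) x.
Proof.
by rewrite -[x](@reprK _ Q) !quotient_scaleE scalerA.
Qed.
Fact quotient_scale1 : left_id 1 quotient_scale.
Proof.
by move=> x; rewrite -[x](@reprK _ Q) quotient_scaleE scale1r.
Qed.
Fact quotient_scaleDr : right_distributive quotient_scale +%R.
Proof.
move=> a x y.
rewrite -[x](@reprK _ Q) -[y](@reprK _ Q).
rewrite -(raddfD (\pi_(Q))) !quotient_scaleE.
by rewrite -(raddfD (\pi_(Q))) scalerDr.
Qed.
Fact quotient_scaleDl x : {morph quotient_scale^~ x : a b / a + b}.
Proof.
move=> a b; rewrite -[x](@reprK _ Q) !quotient_scaleE.
by rewrite -(raddfD (\pi_(Q))) scalerDl.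
Qed.
HB.instance Definition _ := GRing.Zmodule_isLmodule.Build R quotient_module
  quotient_scaleA quotient_scale1 quotient_scaleDr quotient_scaleDl.

End QuotientModule.

Definition Ann M : set R := [set r | forall x : M, r *: x = 0].

Definition fin_gen M : Prop :=
  exists k (g : 'I_k -> M), forall x, exists c : 'I_k -> R,
    x = \sum_(i < k) c i *: g i.

End Submodules.

Arguments restrm {R M} K L _.

Definition noetherian (R : comNzRingType) : Prop :=
  forall I : ideal R, fin_gen (submodule I).

Section Ideals.
Variable R : comNzRingType.
Implicit Types (M : lmodType R) (a : ideal R) (p : prime_idealr R).

Definition ideal_smul a M (L : submodClosed M) : {pred M} :=
  fun x => `[< exists k (c : 'I_k -> R) (y : 'I_k -> M),
    [/\ forall i, c i \in a, forall i, y i \in L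
      & x = \sum_(i < k) c i *: y i] >].

Lemma ideal_smul_closed a M (L : submodClosed M) :
  submod_closed (ideal_smul a L).
Proof.
split=> [|r x y].
  apply/asboolP; exists 0%N, (fun=> 0), (fun=> 0).
  by split=> [[]|[]|] //; rewrite big_ord0.
move=> /asboolP[k [c [u [ca uL ->]]]] /asboolP[l [d [v [da vL ->]]]].
apply/asboolP; exists (k + l)%N.
exists (fun i => match split i with inl j => r * c j | inr j => d j end).
exists (fun i => match split i with inl j => u j | inr j => v j end).
split=> [i|i|].
- by case: (split i) => j //; apply: (@rpredZ R R^o a r _ (ca j)).
- by case: (split i).
rewrite big_split_ord scaler_sumr; congr +%R; apply: eq_bigr => i _.
  by rewrite (unsplitK (inl _ i)) scalerA.
by rewrite (unsplitK (inr _ i)).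
Qed.
HB.instance Definition _ a M (L : submodClosed M) :=
  GRing.isSubmodClosed.Build R M (ideal_smul a L) (ideal_smul_closed a L).

Fixpoint ideal_pow a (k : nat) : ideal R :=
  if k is k'.+1 then ideal_smul a (ideal_pow a k') else topm R^o.

Definition ideal_add a p : set R :=
  [set x | exists u v, [/\ u \in a, v \in p & x = u + v]].

End Ideals.

Section Height.
Variable A : comNzRingType.
Implicit Types (I : set A) (q : prime_idealr A).

Definition prime_chain q (k : nat) : Prop :=
  exists c : nat -> prime_idealr A,
    (forall i, (i < k)%N ->
       {subset c i <= c i.+1} /\ ~ {subset c i.+1 <= c i}) /\
    c k =i q.

Definition prime_height q : enat := enat_sup [set k | prime_chain q k].

(* Primes of infinite height do not affect the infimum, which is [None] when
   no prime ideal contains [I], that is, when [I] is the whole ring. *)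
Definition height I : enat :=
  enat_inf [set n | exists2 q : prime_idealr A,
    I `<=` [set` q] & prime_height q = Some n].

End Height.

Section Localization.
Variables (R : comNzRingType) (p : prime_idealr R) (M : lmodType R).

Definition denominator : Type := {s : R | s \notin p}.
HB.instance Definition _ := SubChoice.on denominator.

Lemma den1_subproof : 1 \notin p. Proof. by rewrite idealr1. Qed.
Definition den1 : denominator := exist _ 1 den1_subproof.

Lemma denM_subproof (s t : denominator) : val s * val t \notin p.
Proof. by rewrite prime_idealrM negb_or (valP s) (valP t). Qed.
Definition denM (s t : denominator) : denominator :=
  exist _ (val s * val t) (denM_subproof s t).

(* The pair [(x, s)] represents the fraction [x / s]. *)
Definition fraction : Type := (M * denominator)%type.
HB.instance Definition _ := Choice.on fraction.

Definition frac_equiv (x y : fraction) : bool :=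
  `[< exists2 u, u \notin p &
      u *: (val y.2 *: x.1) = u *: (val x.2 *: y.1) >].

Lemma frac_equiv_is_equiv : equiv_class_of frac_equiv.
Proof.
split=> [x|x y|y x z].
- by apply/asboolP; exists 1; rewrite ?idealr1.
- by apply/asboolP/asboolP => -[u up e]; exists u.
move=> /asboolP[u up e1] /asboolP[v vp e2]; apply/asboolP.
exists (u * v * val y.2).
  by rewrite !prime_idealrM !negb_or up vp (valP y.2).
move: e1 e2; rewrite !scalerA => e1 e2.
rewrite (_ : _ * val z.2 = v * val z.2 * (u * val y.2)); last by ring.
rewrite -scalerA e1 scalerA.
rewrite (_ : _ * (u * val x.2) = u * val x.2 * (v * val z.2)); last by ring.
rewrite -scalerA e2 scalerA; congr (_ *: _); ring.
Qed.
Canonical frac_equiv_equiv := EquivRelPack frac_equiv_is_equiv.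
Canonical frac_equiv_encModRel := defaultEncModRel frac_equiv.

Definition localization : Type := {eq_quot frac_equiv}.
HB.instance Definition _ : EqQuotient fraction frac_equiv localization :=
  EqQuotient.on localization.
HB.instance Definition _ := Choice.on localization.

Lemma frac_eqP (x y : fraction) :
  (exists2 u, u \notin p &
     u *: (val y.2 *: x.1) = u *: (val x.2 *: y.1)) ->
  \pi_(localization) x = \pi_(localization) y.
Proof. by move=> xy; apply/eqmodP/asboolP. Qed.

Lemma frac_eqE (x y : fraction) :
  \pi_(localization) x = \pi_(localization) y ->
  exists2 u, u \notin p & u *: (val y.2 *: x.1) = u *: (val x.2 *: y.1).
Proof. by move=> /eqmodP/asboolP. Qed.

Definition frac_add (x y : fraction) : fraction :=
  (val y.2 *: x.1 + val x.2 *: y.1, denM x.2 y.2).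
Definition frac_opp (x : fraction) : fraction := (- x.1, x.2).
Definition frac_scale (r : R) (x : fraction) : fraction := (r *: x.1, x.2).

Definition loc_zero : localization := \pi_(localization) (0, den1).
Definition loc_add (x y : localization) : localization :=
  \pi_(localization) (frac_add (repr x) (repr y)).
Definition loc_opp (x : localization) : localization :=
  \pi_(localization) (frac_opp (repr x)).
Definition loc_scale (r : R) (x : localization) : localization :=
  \pi_(localization) (frac_scale r (repr x)).

Lemma scale_eq_trans (c a b a' b' : R) (m m' : M) :
  a' *: m = b' *: m' -> a = c * a' -> c * b' = b -> a *: m = b *: m'.
Proof. by move=> e -> <-; rewrite -!scalerA e. Qed.

Lemma loc_addE x y :
  loc_add (\pi x) (\pi y) = \pi_(localization) (frac_add x y).
Proof.
have [u up ex] := frac_eqE (reprK (\pi_(localization) x)).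
have [v vp ey] := frac_eqE (reprK (\pi_(localization) y)).
rewrite /loc_add; move: (repr _) (repr _) ex ey => y' x'.
rewrite !scalerA => ex ey.
apply: frac_eqP; exists (u * v); first by rewrite prime_idealrM negb_or up.
rewrite /= !scalerDr !scalerA; congr +%R.
  by apply: (scale_eq_trans (c := v * val y.2 * val y'.2) ex); rewrite /=; ring.
by apply: (scale_eq_trans (c := u * val x.2 * val x'.2) ey); rewrite /=; ring.
Qed.

Lemma loc_oppE x : loc_opp (\pi x) = \pi_(localization) (frac_opp x).
Proof.
have [u up ex] := frac_eqE (reprK (\pi_(localization) x)).
by apply: frac_eqP; exists u; rewrite //= !scalerN ex.
Qed.

Lemma loc_scaleE r x :
  loc_scale r (\pi x) = \pi_(localization) (frac_scale r x).
Proof.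
have [u up ex] := frac_eqE (reprK (\pi_(localization) x)).
apply: frac_eqP; exists u => //.
move: ex; rewrite /loc_scale; move: (repr _) => x'; rewrite /= !scalerA => ex.
by apply: (scale_eq_trans (c := r) ex); rewrite /=; ring.
Qed.

Lemma loc_ind (P : localization -> Prop) :
  (forall x, P (\pi x)) -> forall x, P x.
Proof. by move=> Ppi x; rewrite -[x]reprK. Qed.

Fact loc_addA : associative loc_add.
Proof.
elim/loc_ind=> x; elim/loc_ind=> y; elim/loc_ind=> z; rewrite !loc_addE.
apply: frac_eqP; exists 1; first by rewrite idealr1.
rewrite /= !scalerDr !scalerA -addrA; congr (_ *: _ + (_ *: _ + _ *: _)); ring.
Qed.
Fact loc_addC : commutative loc_add.
Proof.
elim/loc_ind=> x; elim/loc_ind=> y; rewrite !loc_addE.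
apply: frac_eqP; exists 1; first by rewrite idealr1.
rewrite /= !scalerDr !scalerA addrC; congr (_ *: _ + _ *: _); ring.
Qed.
Fact loc_add0 : left_id loc_zero loc_add.
Proof.
elim/loc_ind=> x; rewrite loc_addE.
apply: frac_eqP; exists 1; first by rewrite idealr1.
rewrite /= !scalerDr !scalerA scaler0 add0r; congr (_ *: _); ring.
Qed.
Fact loc_addN : left_inverse loc_zero loc_opp loc_add.
Proof.
elim/loc_ind=> x; rewrite loc_oppE loc_addE.
apply: frac_eqP; exists 1; first by rewrite idealr1.
by rewrite /= scalerN addNr !scaler0.
Qed.
HB.instance Definition _ := GRing.isZmodule.Build localization
  loc_addA loc_addC loc_add0 loc_addN.

Lemma loc_piD x y :
  \pi_(localization) x + \pi_(localization) y =
    \pi_(localization) (frac_add x y).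
Proof. exact: loc_addE. Qed.

Fact loc_scaleA a b x : loc_scale a (loc_scale b x) = loc_scale (a * b) x.
Proof.
by elim/loc_ind: x => x; rewrite !loc_scaleE /frac_scale /= scalerA.
Qed.
Fact loc_scale1 : left_id 1 loc_scale.
Proof.
by elim/loc_ind=> -[m s]; rewrite loc_scaleE /frac_scale /= scale1r.
Qed.
Fact loc_scaleDr : right_distributive loc_scale +%R.
Proof.
move=> a; elim/loc_ind=> x; elim/loc_ind=> y.
rewrite loc_piD !loc_scaleE loc_piD /frac_scale /frac_add /=.
by rewrite scalerDr !scalerA ![a * _]mulrC.
Qed.
Fact loc_scaleDl x : {morph loc_scale^~ x : a b / a + b}.
Proof.
move=> a b; elim/loc_ind: x => x; rewrite !loc_scaleE loc_piD.
apply: frac_eqP; exists 1; first by rewrite idealr1.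
rewrite /= !scalerDr !scalerA -scalerDl; congr (_ *: _); ring.
Qed.
HB.instance Definition _ := GRing.Zmodule_isLmodule.Build R localization
  loc_scaleA loc_scale1 loc_scaleDr loc_scaleDl.

Lemma loc_piZ r x :
  r *: \pi_(localization) x = \pi_(localization) (frac_scale r x).
Proof. exact: loc_scaleE. Qed.

Definition loc_map (m : M) : localization := \pi_(localization) (m, den1).

Fact loc_map_linear : linear loc_map.
Proof.
move=> a x y; rewrite /loc_map loc_piZ loc_piD.
apply: frac_eqP; exists 1; first by rewrite idealr1.
by rewrite /= mulr1 !scale1r.
Qed.
HB.instance Definition _ := GRing.isLinear.Build R M localization _ loc_map
  loc_map_linear.

End Localization.

Section AssociatedPrimes.
Variables (R : comNzRingType) (a : ideal R) (N : lmodType R).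

(* Sets of prime ideals are given by their membership predicates: using [set]
   on the type [prime_idealr R] raises a universe inconsistency. *)
Definition Ass (p : prime_idealr R) : Prop :=
  exists x : N, forall r : R, r \in p <-> r *: x = 0.

Definition MinAss (p : prime_idealr R) : Prop :=
  Ass p /\
  forall q : prime_idealr R, Ass q -> {subset q <= p} -> {subset p <= q}.

Definition loc_kernel (p : prime_idealr R) : submodClosed N :=
  kerm (@loc_map R p N).

Definition S_sub : submodClosed N :=
  bigcapm (fun p => Ass p /\ ideal_add a p <> setT) loc_kernel.

Definition height_mod (p : prime_idealr R) : enat :=
  height [set \pi_({ideal_quot p}) x | x in ideal_add a p].

End AssociatedPrimes.

Arguments Ass {R} N _.
Arguments MinAss {R} N _.
Arguments loc_kernel {R} N p.

Section LocalCohomology.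
Variable R : comNzRingType.
Implicit Types M : lmodType R.

Definition cocycles (C : nat -> lmodType R)
    (d : forall i, {linear C i -> C i.+1}) (i : nat) : submodClosed (C i) :=
  kerm (d i).

Definition coboundaries (C : nat -> lmodType R)
    (d : forall i, {linear C i -> C i.+1}) (i : nat) : submodClosed (C i) :=
  match i with
  | 0 => zerom (C 0)
  | j.+1 => imm (d j)
  end.

Definition cohomology (C : nat -> lmodType R)
    (d : forall i, {linear C i -> C i.+1}) (i : nat) : lmodType R :=
  quotient_module (restrm (cocycles d i) (coboundaries d i)).

Definition injective_module (E : lmodType R) : Prop :=
  forall (A B : lmodType R) (f : {linear A -> B}) (g : {linear A -> E}),
    injective f -> exists h : {linear B -> E}, forall x, h (f x) = g x.

Record injective_resolution (N : lmodType R) := InjectiveResolution {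
  ires_obj :> nat -> lmodType R;
  ires_aug : {linear N -> ires_obj 0};
  ires_d : forall i, {linear ires_obj i -> ires_obj i.+1};
  ires_injective : forall i, injective_module (ires_obj i);
  ires_aug_inj : injective ires_aug;
  ires_exact0 : kerm (ires_d 0) =i imm ires_aug;
  ires_exact : forall i, kerm (ires_d i.+1) =i imm (ires_d i)
}.

Variable a : ideal R.

Definition torsion M : {pred M} :=
  fun x => `[< exists k, forall r : R, r \in ideal_pow a k -> r *: x = 0 >].

Lemma ideal_pow_decr j k : (j <= k)%N ->
  {subset ideal_pow a k <= ideal_pow a j}.
Proof.
move=> /subnK <-; elim: (k - j)%N => [//|l IHl] x.
rewrite addSn /= => /asboolP[m [c [y [_ yP ->]]]].
by apply: rpred_sum => i _; apply: rpredZ; apply: IHl.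
Qed.

Lemma torsion_closed M : submod_closed (@torsion M).
Proof.
split=> [|b x y].
  by apply/asboolP; exists 0%N => r _; rewrite scaler0.
move=> /asboolP[j jx] /asboolP[k ky]; apply/asboolP.
exists (maxn j k) => r rP.
rewrite scalerDr scalerA mulrC -scalerA jx; last first.
  exact: ideal_pow_decr (leq_maxl j k) _ rP.
by rewrite ky ?scaler0 ?addr0 //; exact: ideal_pow_decr (leq_maxr j k) _ rP.
Qed.
HB.instance Definition _ M := GRing.isSubmodClosed.Build R M (@torsion M)
  (@torsion_closed M).

(* [Gamma] and [Gamma_map] form the [a]-torsion functor. *)
Definition Gamma M : lmodType R := submodule (@torsion M).

Lemma Gamma_map_subproof M M' (f : {linear M -> M'}) (x : Gamma M) :
  f (val x) \in @torsion M'.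
Proof.
have /asboolP[k kx] := valP x; apply/asboolP.
by exists k => r rk; rewrite -linearZ /= kx ?linear0.
Qed.

Definition Gamma_map M M' (f : {linear M -> M'}) (x : Gamma M) : Gamma M' :=
  exist _ (f (val x)) (Gamma_map_subproof f x).

Fact Gamma_map_linear M M' (f : {linear M -> M'}) : linear (Gamma_map f).
Proof. by move=> b x y; apply: val_inj; rewrite /= !linearP. Qed.
HB.instance Definition _ M M' (f : {linear M -> M'}) :=
  GRing.isLinear.Build R (Gamma M) (Gamma M') _ (Gamma_map f)
    (Gamma_map_linear f).

Variables (N : lmodType R) (E : injective_resolution N).

(* The right derived functors of [Gamma], computed on the injective resolution
   [E] of [N]; up to isomorphism the result does not depend on [E]. *)
Definition local_cohomology (i : nat) : lmodType R :=
  @cohomology (fun j => Gamma (E j)) (fun j => Gamma_map (ires_d E j)) i.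

Definition depth : enat :=
  enat_inf [set i | exists x : local_cohomology i, x != 0].

End LocalCohomology.

(* Main.v *)
Require Import Defs.
From HB Require Import structures.
From mathcomp Require Import all_boot all_order all_algebra.
From mathcomp Require Import generic_quotient ring_quotient.
From mathcomp Require Import boolp classical_sets.
From mathcomp Require Import ring.
Set Implicit Arguments.
Unset Strict Implicit.
Unset Printing Implicit Defensive.
Import GRing.Theory.
Local Open Scope classical_set_scope.
Local Open Scope quotient_scope.
Local Open Scope ring_scope.

(* The first inclusion: by primality of maximal annihilators, S(a, N) is killed
   by some 1 - c with c in a, so if r N is contained in S(a, N), then
   (1 - c) r kills N, hence H^n_a(N); as H^n_a(N) is a-torsion, r kills it.

   The second one: for p with ht((a + p)/p) = n, it suffices that r kills the
   p-torsion of N_p, which is N_p when p is minimal in Ass N, and nonzero when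
   p is in Ass N.  Fix a prime Q containing a + p with ht(Q/p) <= n and induct
   on n.  If n = 0, then a is contained in p and H^0 contains the p-torsion.
   If n > 0, some x in a is regular on N, and for all k, H^(n-1)_a(N/x^k N)
   embeds in H^n_a(N), so it is killed by r.  For P' minimal over p + (x)
   inside Q, the p-torsion of N becomes P'-torsion in (N/x^k N)_P', so by
   induction r maps it to x^k N_P' for all k, hence to 0 by Krull.

   To avoid resolving N/x^k N, the induction carries a complex of injectives
   whose only cohomology is N/L, in some degree e: the cone of x^k on it has
   N/(L + x^k N) as its only cohomology, in degree e + 1. *)

(** * Noetherian modules *)

Section Submod.
Variable R : comNzRingType.
Implicit Types (M : lmodType R).

(** Unbundled, so that any predicate can serve; in the induction a quotient M/L is represented by
    the pair of [M] and [L]. *)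
Definition submod M (L : M -> Prop) : Prop :=
  [/\ L 0, forall x y, L x -> L y -> L (x + y) & forall c x, L x -> L (c *: x)].

Lemma submodB M (L : M -> Prop) x y : submod L -> L x -> L y -> L (x - y).
Proof. by case=> _ LD LZ Lx Ly; rewrite -scaleN1r; apply: LD (LZ _ _ _). Qed.

Lemma submod_sum M (L : M -> Prop) (I : finType) (F : I -> M) :
  submod L -> (forall i, L (F i)) -> L (\sum_i F i).
Proof. by case=> L0 LD _ LF; elim/big_ind: _. Qed.

Lemma submod_cancel M (L : M -> Prop) x y :
  submod L -> L (x + y) -> L y -> L x.
Proof. by move=> sL Lxy Ly; rewrite -(addrK y x); apply: submodB. Qed.

Lemma submod_pred M (L : submodClosed M) : submod (fun x => x \in L).
Proof.
by split=> [|x y|c x] *; rewrite ?rpred0 ?rpredD //; apply: (@rpredZ R M L).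
Qed.

Fixpoint span M (s : seq M) (x : M) : Prop :=
  if s is g :: s' then exists c y, span s' y /\ x = c *: g + y else x = 0.

Lemma submod_span M (s : seq M) : submod (span s).
Proof.
elim: s => [|g s [s0 sD sZ]].
  by split=> [|x y -> ->|c x ->] //=; rewrite ?addr0 ?scaler0.
split=> [|_ _ [c [x [sx ->]]] [d [y [sy ->]]]|c _ [d [x [sx ->]]]] /=.
- by exists 0, 0; rewrite scale0r addr0.
- by exists (c + d), (x + y); rewrite scalerDl addrACA; split=> //; apply: sD.
- by exists (c * d), (c *: x); rewrite scalerDr scalerA; split=> //; apply: sZ.
Qed.

Lemma mem_span M (s : seq M) x : x \in s -> span s x.
Proof.
elim: s => // g s IHs; rewrite inE => /predU1P[->|/IHs sx] /=.
  by exists 1, 0; rewrite scale1r addr0; split=> //; case: (submod_span s).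
by exists 0, x; rewrite scale0r add0r.
Qed.

Lemma span_min M (L : M -> Prop) (s : seq M) :
  submod L -> (forall x, x \in s -> L x) -> forall x, span s x -> L x.
Proof.
move=> [L0 LD LZ]; elim: s => [_ x -> //|g s IHs Ls x [c [y [sy ->]]]].
apply: LD; first by apply: LZ; apply: Ls; rewrite inE eqxx.
by apply: IHs => // z zs; apply: Ls; rewrite inE zs orbT.
Qed.

Definition fgen M (L : M -> Prop) : Prop :=
  exists s : seq M, (forall x, x \in s -> L x) /\ forall x, L x -> span s x.

Definition noeth M : Prop := forall L : M -> Prop, submod L -> fgen L.

Lemma noeth_ring : noetherian R -> noeth R^o.
Proof.
move=> nR L sL; pose P : {pred R^o} := fun x => `[< L x >].
have cP : submod_closed P.
  case: sL => L0 LD LZ; split; first exact/asboolP.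
  by move=> c x y /asboolP Lx /asboolP Ly; apply/asboolP/LD/Ly/LZ.
pose PB := GRing.isSubmodClosed.Build R R^o P cP.
pose I : ideal R := HB.pack P PB.
have [k [g gI]] := nR I.
exists [seq val (g i) | i <- enum 'I_k]; split=> [_ /mapP[i _ ->]|x Lx].
  by have /asboolP := valP (g i).
have xI : x \in I by apply/asboolP.
have [c /(congr1 (val : submodule I -> R^o)) xE] := gI (exist _ x xI).
rewrite -[x]/(val (exist _ x xI : submodule I)) xE.
rewrite (raddf_sum (val : submodule I -> R^o)).
apply: submod_sum (submod_span _) _ => i.
have [_ _ sZ] := submod_span [seq val (g j) | j <- enum 'I_k].
by apply: sZ; apply/mem_span/map_f; rewrite mem_enum.
Qed.

(** Induction on the generators: the coefficients of [g] in elements of [L] form an ideal, and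
    finitely many elements of [L] realizing its generators reduce [L] to its part inside the span of
    [gs]. *)
Lemma fgen_span M (g : seq M) (L : M -> Prop) :
  noeth R^o -> submod L -> (forall x, L x -> span g x) -> fgen L.
Proof.
move=> nR; elim: g L => [|g gs IHg] L sL Lg.
  by exists [::]; split.
have [L0 LD LZ] := sL; have [g0 gD gZ] := submod_span gs.
pose I (c : R^o) := exists y, span gs y /\ L (c *: g + y).
have sI : submod I.
  split=> [|c d [y [gy Ly]] [z [gz Lz]]|c d [y [gy Ly]]].
  - by exists 0; rewrite scale0r addr0.
  - exists (y + z); split; first exact: gD.
    by rewrite scalerDl addrACA; apply: LD.
  - exists (c *: y); split; first exact: gZ.
    by rewrite -scalerA -scalerDr; apply: LZ.
have [s [sI1 sI2]] := nR I sI.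
have [t [tL tI]] : exists t : seq M, (forall x, x \in t -> L x) /\
    forall c : R^o, span s c ->
      exists u y, [/\ span t u, span gs y & u = c *: g + y].
  elim: s {sI2} sI1 => [_|c s IHs sI1].
    exists [::]; split=> // c ->; exists 0, 0.
    by rewrite scale0r addr0.
  have [|t [tL tI]] := IHs.
    by move=> x xs; apply: sI1; rewrite inE xs orbT.
  have [y [gy Ly]] := sI1 c (mem_head _ _).
  exists (c *: g + y :: t); split=> [x|_ [b [d [sd ->]]]].
    by rewrite inE => /predU1P[->|/tL].
  have [u [z [tu gz uE]]] := tI d sd.
  exists (b *: (c *: g + y) + u), (b *: y + z); split.
  - by exists b, u.
  - by apply: gD gz; apply: gZ.
  - by rewrite uE scalerDr scalerDl addrACA scalerA.
have [||t0 [t0L Lt0]] := IHg (fun x => L x /\ span gs x).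
- split=> [|x y [Lx gx] [Ly gy]|c x [Lx gx]]; first by [].
    by split; [apply: LD|apply: gD].
  by split; [apply: LZ|apply: gZ].
- by move=> x [].
exists (t ++ t0); split=> [x|x Lx].
  by rewrite mem_cat => /orP[/tL|/t0L[]].
have [c [y [gy xE]]] := Lg x Lx.
have [|u [z [tu gz uE]]] := tI c.
  by apply: sI2; exists y; rewrite -xE.
have sub v w :
    (forall x, x \in v -> x \in t ++ t0) -> span v w -> span (t ++ t0) w.
  by move=> vt; apply: span_min (submod_span _) _ _ => e /vt/mem_span.
have [_ tD _] := submod_span (t ++ t0).
rewrite -(subrK u x); apply: tD; last first.
  by apply: sub tu => e; rewrite mem_cat => ->.
apply: (sub t0) => [e|]; first by rewrite mem_cat orbC => ->.
apply: Lt0; split.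
  by apply: submodB => //; apply: span_min tu.
by rewrite xE uE opprD addrACA subrr add0r; apply: submodB (submod_span _) _ _.
Qed.

Lemma noeth_fin_gen M : noetherian R -> fin_gen M -> noeth M.
Proof.
move=> /noeth_ring nR [k [g gM]] L sL.
apply: (@fgen_span M [seq g i | i <- enum 'I_k]) => // x _.
have [c ->] := gM x; have [_ _ sZ] := submod_span [seq g j | j <- enum 'I_k].
apply: submod_sum (submod_span _) _ => i.
by apply: sZ; apply/mem_span/map_f; rewrite mem_enum.
Qed.

(** Otherwise dependent choice gives a strictly increasing sequence in [F]; its union is finitely
    generated, hence reached at a finite stage. *)
Lemma noeth_max M (F : (M -> Prop) -> Prop) (L0 : M -> Prop) :
    noeth M -> (forall L, F L -> submod L) -> F L0 ->
  exists2 L, F L & forall L', F L' -> (forall x, L x -> L' x) ->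
    forall x, L' x -> L x.
Proof.
move=> nM sF F0; apply: contrapT => nmax.
have next (L : {L | F L}) : exists L' : {L | F L},
    (forall x, sval L x -> sval L' x) /\ exists2 x, sval L' x & ~ sval L x.
  apply: contrapT => nL; apply: nmax; exists (sval L); first exact: (svalP L).
  move=> L' FL' LL' x L'x; apply: contrapT => nLx; apply: nL.
  by exists (exist _ L' FL'); split=> //; exists x.
have [f fP] := choice next.
pose c k := iter k f (exist _ L0 F0).
have cS j k : (j <= k)%N -> forall x, sval (c j) x -> sval (c k) x.
  move=> /subnK <-; elim: (k - j)%N => // l IHl x /IHl.
  by rewrite addSn; apply: (fP _).1.
pose U x := exists k, sval (c k) x.
have sU : submod U.
  split=> [|x y [j xj] [k yk]|b x [k xk]].
  - by exists 0%N; case: (sF _ F0).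
  - exists (maxn j k); case: (sF _ (svalP (c (maxn j k)))) => _ LD _.
    by apply: LD; [apply: cS xj|apply: cS yk]; rewrite ?leq_maxl ?leq_maxr.
  - by exists k; case: (sF _ (svalP (c k))) => _ _; apply.
have [s [sL Us]] := nM U sU.
have [k ck] : exists k, forall x, x \in s -> sval (c k) x.
  elim: s sL {Us} => [|g s IHs] sL; first by exists 0%N.
  have [j gj] := sL g (mem_head _ _).
  have [|k sk] := IHs; first by move=> x xs; apply: sL; rewrite inE xs orbT.
  exists (maxn j k) => x; rewrite inE => /predU1P[->|/sk].
    by apply: cS gj; rewrite leq_maxl.
  by apply: cS; rewrite leq_maxr.
have [_ [x cx]] := fP (c k); apply.
apply: (span_min (sF _ (svalP (c k))) ck); apply: Us.
by exists k.+1.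
Qed.

End Submod.

(** * Primes and associated primes *)

Section Primes.
Variable R : comNzRingType.
Implicit Types (M : lmodType R) (P Q : R^o -> Prop).

(** The annihilator of the class of [y] in M/L; when prime, it is an associated prime of M/L. *)
Definition ann M (L : M -> Prop) (y : M) : R^o -> Prop := fun r => L (r *: y).

Definition addm M (L : M -> Prop) (x : R) : M -> Prop :=
  fun y => exists l v, L l /\ y = l + x *: v.

Definition is_prime P : Prop :=
  [/\ submod P, ~ P 1 & forall x y, P (x * y) -> P x \/ P y].

Definition mult_set (S : R -> Prop) : Prop :=
  S 1 /\ forall x y, S x -> S y -> S (x * y).

Lemma mult_set1 : mult_set (fun s => s = 1).
Proof. by split=> // _ _ -> ->; rewrite mulr1. Qed.

Lemma submod_ann M (L : M -> Prop) y : submod L -> submod (ann L y).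
Proof.
case=> L0 LD LZ; split=> [|r s Lr Ls|c r Lr]; rewrite /ann.
- by rewrite scale0r.
- by rewrite scalerDl; apply: LD.
- by rewrite -[c *: r]/(c * r) -scalerA; apply: LZ.
Qed.

Lemma submod_addm M (L : M -> Prop) x : submod L -> submod (addm L x).
Proof.
case=> L0 LD LZ; split=> [|_ _ [l [v [Ll ->]]] [m [w [Lm ->]]]|].
- by exists 0, 0; rewrite scaler0 addr0.
- by exists (l + m), (v + w); rewrite scalerDr addrACA; split=> //; apply: LD.
- move=> c _ [l [v [Ll ->]]]; exists (c *: l), (c *: v).
  by rewrite scalerDr !scalerA mulrC; split=> //; apply: LZ.
Qed.

Lemma sub_addm M (L : M -> Prop) x y : L y -> addm L x y.
Proof. by move=> Ly; exists y, 0; rewrite scaler0 addr0. Qed.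

Lemma mem_addm M (L : M -> Prop) x v : submod L -> addm L x (x *: v).
Proof. by case=> L0 _ _; exists 0, v; rewrite add0r. Qed.

Lemma prime_mull P c r : is_prime P -> P r -> P (c * r).
Proof. by case=> -[_ _ PZ] _ _ Pr; apply: (PZ c r). Qed.

Lemma prime_mulN P x y : is_prime P -> ~ P x -> ~ P y -> ~ P (x * y).
Proof. by case=> _ _ PM nx ny /PM[]. Qed.

Lemma prime_exp P x m : is_prime P -> P (x ^+ m) -> P x.
Proof.
move=> pP; elim: m => [|m IHm]; first by rewrite expr0 => P1; case: pP.
by rewrite exprS; case: pP => _ _ PM /PM[|/IHm].
Qed.

Lemma scaler_swap M (b c : R) (y : M) : b *: (c *: y) = c *: (b *: y).
Proof. by rewrite !scalerA mulrC. Qed.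

Lemma ann_scale M (L : M -> Prop) c y r :
  submod L -> ann L y r -> ann L (c *: y) r.
Proof. by case=> _ _ LZ Lr; rewrite /ann (scaler_swap r); apply: LZ. Qed.

(** A maximal member of the family of [ann L (c *: y)] disjoint from [S] is prime. *)
Lemma assoc_prime M (L : M -> Prop) (S : R -> Prop) y :
    noeth R^o -> submod L -> mult_set S -> (forall s, S s -> ~ L (s *: y)) ->
  exists c, is_prime (ann L (c *: y)) /\ forall s, S s -> ~ ann L (c *: y) s.
Proof.
move=> nR sL [S1 SM] Sy; have [L0 LD LZ] := sL.
pose F I := exists2 c, I = ann L (c *: y) & forall s, S s -> ~ I s.
have sF I : F I -> submod I by case=> c -> _; apply: submod_ann.
have [|_ [c -> Sc] cmax] := noeth_max nR sF (L0 := ann L (1 *: y)).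
  by exists 1 => // s Ss; rewrite /ann scale1r; apply: Sy.
exists c; split=> //; split; first exact: submod_ann.
  exact: Sc.
move=> a b; rewrite /ann -scalerA => Lab.
have [Lb|nLb] := pselect (L (b *: (c *: y))); [by right|left].
apply: (cmax (ann L ((b * c) *: y))); last by rewrite /ann -scalerA.
  exists (b * c) => // s Ss; rewrite /ann -scalerA => Lsb; apply: nLb.
  (* As [s] is in [S], this larger ideal is still disjoint from [S], so by maximality it is the
     chosen one; it contains [b]. *)
  apply: (cmax (ann L ((s * c) *: y))).
  - exists (s * c) => // t St; rewrite /ann -scalerA (scalerA t).
    by apply: Sc; apply: SM.
  - by move=> r Lr; rewrite -scalerA; apply: ann_scale.
  - by rewrite /ann -scalerA (scaler_swap b s).
by move=> r Lr; rewrite -scalerA; apply: ann_scale.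
Qed.

Lemma prime_disjoint (J : R^o -> Prop) (S : R -> Prop) :
    noeth R^o -> submod J -> mult_set S -> (forall s, S s -> ~ J s) ->
  exists P, [/\ is_prime P, forall x, J x -> P x & forall s, S s -> ~ P s].
Proof.
move=> nR sJ mS JS; have [|c [pP SP]] := @assoc_prime R^o J S 1 nR sJ mS.
  by move=> s Ss; rewrite -[s *: 1]/(s * 1) mulr1; apply: JS.
exists (ann J (c *: (1 : R^o))); split=> // x Jx.
rewrite /ann -[_ *: _]/(x * (c * 1)) mulrC.
by case: sJ => _ _ JZ; apply: JZ.
Qed.

Lemma prime_avoidance (A : R^o -> Prop) (l : seq (R^o -> Prop)) :
    submod A ->
    (forall P, List.In P l -> is_prime P /\ exists2 x, A x & ~ P x) ->
  exists2 x, A x & forall P, List.In P l -> ~ P x.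
Proof.
move=> sA; have [A0 AD AZ] := sA.
have [m] := ubnP (size l); elim: m l => // m IHm [|P l] /= lm lP.
  by exists 0.
have [|x Ax lx] := IHm l lm; first by move=> Q lQ; apply: lP; right.
have [pP [b Ab nPb]] := lP P (or_introl erefl).
have [Px|nPx] := pselect (P x); last first.
  by exists x => // Q [<- //|]; apply: lx.
have [[Q lQ QP]|nQP] :=
    pselect (exists2 Q, List.In Q l & forall z, Q z -> P z).
  have [l1 [l2 lE]] := List.in_split Q l lQ.
  have [||y Ay ly] := IHm (P :: l1 ++ l2).
  - by move: lm; rewrite lE /= !size_cat /= addnS.
  - move=> Q' lQ'; apply: lP; case: lQ' => [|lQ']; [by left|right].
    rewrite lE; apply/List.in_or_app.
    by case: (List.in_app_or _ _ _ lQ'); [left|right; right].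
  have nPy : ~ P y by apply: ly; left.
  exists y => // Q' [<- //|]; rewrite lE => lQ'.
  have [?|[<- /QP //|?]] := List.in_app_or _ _ _ lQ'.
    by apply: ly; right; apply/List.in_or_app; left.
  by apply: ly; right; apply/List.in_or_app; right.
(* [w] is the product of [b] and one element outside [P] from each prime of [l]; then [x + w] avoids
   [P] and, like [x], all of [l]. *)
have [w [Aw nPw lw]] : exists w, [/\ A w, ~ P w & forall Q, List.In Q l -> Q w].
  have pl Q : List.In Q l -> is_prime Q by move=> lQ; apply: (lP Q _).1; right.
  elim: l nQP pl {lm lP lx} => [|Q l IHl] nQP pl; first by exists b.
  have [||w [Aw nPw lw]] := IHl.
  - by move=> [Q' lQ' Q'P]; apply: nQP; exists Q' => //; right.
  - by move=> Q' lQ'; apply: pl; right.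
  have [z Qz nPz] : exists2 z, Q z & ~ P z.
    apply: contrapT => nz; apply: nQP; exists Q; first by left.
    by move=> z Qz; apply: contrapT => nPz; apply: nz; exists z.
  exists (z * w); split; first exact: AZ.
    exact: prime_mulN.
  move=> Q' [<-|lQ']; last by apply: prime_mull (lw _ lQ'); apply: pl; right.
  by rewrite mulrC; apply: prime_mull => //; apply: pl; left.
exists (x + w); first exact: AD.
move=> Q [<-|lQ] Qxw.
  apply: nPw; case: pP => sP _ _.
  by apply: (submod_cancel (y := x) sP) => //; rewrite addrC.
have [sQ _ _] := (lP Q (or_intror lQ)).1.
by apply: (lx Q lQ); apply: submod_cancel sQ Qxw (lw _ lQ).
Qed.

(** Noetherian induction: take a maximal counterexample [L1], an associated prime [ann L1 y0], and
    L2 = L1 + R y0. All nonzero elements of L2/L1 have annihilator [ann L1 y0], so M/L1 has at most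
    this associated prime besides those of M/L2. *)
Lemma finite_ass M (L : M -> Prop) :
    noeth M -> submod L ->
  exists l : seq (R^o -> Prop),
    forall y, is_prime (ann L y) -> List.In (ann L y) l.
Proof.
move=> nM sL; apply: contrapT => nL.
pose F (L : M -> Prop) := submod L /\ ~ exists l : seq (R^o -> Prop),
    forall y, is_prime (ann L y) -> List.In (ann L y) l.
have [|L1 [sL1 nL1] L1max] := noeth_max (F := F) nM _ (conj sL nL).
  by move=> ? [].
have [L0 LD LZ] := sL1.
have [[y0 py0]|np] := pselect (exists y, is_prime (ann L1 y)); last first.
  by apply: nL1; exists [::] => y py; apply: np; exists y.
have [_ ny0 _] := py0.
pose L2 := fun x => exists l c, L1 l /\ x = l + c *: y0.
have sL2 : submod L2.
  split=> [|_ _ [l [c [Ll ->]]] [m [d [Lm ->]]]|b _ [l [c [Ll ->]]]].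
  - by exists 0, 0; rewrite scale0r addr0.
  - by exists (l + m), (c + d); rewrite scalerDl addrACA; split=> //; apply: LD.
  - exists (b *: l), (b * c); rewrite scalerDr scalerA.
    by split=> //; apply: LZ.
have sub x : L1 x -> L2 x by exists x, 0; rewrite scale0r addr0.
have [[l lL2]|nL2] := pselect (exists l : seq (R^o -> Prop),
    forall y, is_prime (ann L2 y) -> List.In (ann L2 y) l); last first.
  apply: ny0; rewrite /ann scale1r; apply: (L1max L2) => //.
  by exists 0, 1; rewrite scale1r add0r.
apply: nL1; exists (ann L1 y0 :: l) => y py; have [_ _ pM] := py.
have [[c L2c nL1c]|nc] :=
    pselect (exists2 c, L2 (c *: y) & ~ L1 (c *: y)); last first.
  right; have -> : ann L1 y = ann L2 y; last first.
    apply: lL2; suff <- : ann L1 y = ann L2 y by [].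
    apply/predeqP => r; split=> [/sub //|L2r].
    by apply: contrapT => nr; apply: nc; exists r.
  apply/predeqP => r; split=> [/sub //|L2r].
  by apply: contrapT => nr; apply: nc; exists r.
left; have [u [d [Lu cE]]] := L2c.
have nd : ~ ann L1 y0 d.
  by move=> Ld; apply: nL1c; rewrite cE; apply: LD.
have [_ _ p0M] := py0.
have annE r : L1 (r *: (c *: y)) <-> L1 (r *: (d *: y0)).
  rewrite cE scalerDr; split; last by apply: LD; apply: LZ.
  by rewrite addrC => /(submod_cancel sL1); apply; apply: LZ.
apply/predeqP => r; split=> Lr.
  have : L1 (r *: (d *: y0)) by exact: ann_scale.
  by move/annE; rewrite scalerA => /pM[].
have : L1 (r *: (c *: y)) by exact: ann_scale.
by move/annE; rewrite scalerA => /p0M[].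
Qed.

(** By hypothesis [A] lies in no associated prime of M/L; an element avoiding these finitely many
    primes is regular on M/L. *)
Lemma regular_element M (L : M -> Prop) (A : R^o -> Prop) :
    noeth R^o -> noeth M -> submod L -> submod A ->
    (forall y, (forall c, A c -> L (c *: y)) -> L y) ->
  exists2 x, A x & forall y, L (x *: y) -> L y.
Proof.
move=> nR nM sL sA AL; have [L0 LD LZ] := sL.
have [l lL] := finite_ass nM sL.
pose good P := `[< is_prime P /\ exists y, P = ann L y >].
have [P|x Ax lx] := @prime_avoidance A (List.filter good l) sA.
  move=> /List.filter_In[_ /asboolP[pP [y PE]]]; split=> //.
  apply: contrapT => nP; case: pP => _ nP1 _; apply: nP1.
  rewrite PE /ann scale1r; apply: AL => c Ac; apply: contrapT => nc; apply: nP.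
  by exists c => //; rewrite PE.
exists x => // y Lxy; apply: contrapT => nLy.
have [|c [pc _]] := assoc_prime nR sL mult_set1 (y := y).
  by move=> _ ->; rewrite scale1r.
apply: (lx (ann L (c *: y))); last exact: ann_scale.
apply/List.filter_In; split; first exact: lL.
by apply/asboolP; split=> //; exists (c *: y).
Qed.

(** The submodules C_k of all v with x^k v in L + R w increase, so C_(k+1) = C_k for some k. Then s
    w = l + x^(k+1) v yields x^k v = m + c w, so (s - c x) w is in [L], with s - c x outside [P]. *)
Lemma krull_intersection M (L : M -> Prop) P (x : R) (w : M) :
    noeth M -> submod L -> is_prime P -> P x ->
    (forall k, exists2 s, ~ P s & addm L (x ^+ k) (s *: w)) ->
  exists2 s, ~ P s & L (s *: w).
Proof.
move=> nM sL pP Px Lk; have [L0 LD LZ] := sL.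
pose C k v := exists l c, L l /\ x ^+ k *: v = l + c *: w.
have sC k : submod (C k).
  split=> [|v v' [l [c [Ll vE]]] [m [d [Lm v'E]]]|b v [l [c [Ll vE]]]].
  - by exists 0, 0; rewrite scale0r scaler0 addr0.
  - exists (l + m), (c + d); rewrite scalerDl addrACA -vE -v'E scalerDr.
    by split=> //; apply: LD.
  - exists (b *: l), (b * c); rewrite -scalerA -scalerDr -vE !scalerA mulrC.
    by split=> //; apply: LZ.
have [||_ [k ->] kmax] :=
    noeth_max (F := fun L' => exists k, L' = C k) (L0 := C 0%N) nM.
- by move=> _ [k ->].
- by exists 0%N.
have [s nPs [l [v [Ll sE]]]] := Lk k.+1.
have [|||m [c [Lm vE]]] := kmax (C k.+1) _ _ v.
- by exists k.+1.
- move=> u [m [c [Lm uE]]]; exists (x *: m), (x * c).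
  by rewrite exprS -!scalerA -scalerDr -uE; split=> //; apply: LZ.
- exists (- l), s; rewrite sE addKr; split=> //.
  by rewrite -scaleN1r; apply: LZ.
exists (s - c * x).
  move=> Ps; apply: nPs; have [sP _ _] := pP.
  rewrite -(subrK (c * x) s); case: sP => _ PD _; apply: PD => //.
  exact: prime_mull.
rewrite scalerBl sE exprS -scalerA vE scalerDr !scalerA (mulrC c x).
rewrite addrA addrK; apply: LD => //; exact: LZ.
Qed.

(* If [P] is contained in [Q], this says that [ht(Q/P) <= n]. *)
Fixpoint height_le (n : nat) P Q : Prop :=
  if n is n'.+1 then
    forall P', is_prime P' -> (forall x, P x -> P' x) ->
      ~ (forall x, P' x -> P x) -> (forall x, P' x -> Q x) -> height_le n' P' Q
  else forall x, Q x -> P x.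

(** A chain of primes from [P] to [Q'] becomes longer by appending [Q]. *)
Lemma height_le_lower n P Q Q' : height_le n.+1 P Q -> is_prime Q' ->
    (forall x, P x -> Q' x) -> (forall x, Q' x -> Q x) ->
  ~ (forall x, Q x -> Q' x) -> height_le n P Q'.
Proof.
move=> hPQ pQ' PQ' Q'Q nQQ'; elim: n P hPQ PQ' => [|n IHn] P hPQ PQ'.
  by apply: contrapT => nQ'P; apply: nQQ'; apply: hPQ PQ' nQ'P Q'Q.
move=> P' pP' PP' nP'P P'Q'; apply: IHn => //.
by apply: hPQ => // x /P'Q'/Q'Q.
Qed.

(** The height bound replaces Zorn's lemma: while [Q] is not minimal, passing to a smaller prime
    lowers the bound by one. *)
Lemma minimal_prime n P Q (x : R) :
    height_le n P Q -> is_prime Q -> (forall z, P z -> Q z) -> Q x ->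
  exists P', [/\ is_prime P', forall z, P z -> P' z, P' x,
    forall z, P' z -> Q z
    & forall P'', is_prime P'' -> (forall z, P z -> P'' z) -> P'' x ->
      (forall z, P'' z -> P' z) -> forall z, P' z -> P'' z].
Proof.
elim: n Q => [|n IHn] Q hPQ pQ PQ Qx.
  by exists Q; split=> // P'' _ PP'' _ _ z /hPQ/PP''.
have [Qmin|] := pselect (forall P'', is_prime P'' -> (forall z, P z -> P'' z) ->
    P'' x -> (forall z, P'' z -> Q z) -> forall z, Q z -> P'' z).
  by exists Q.
move=> /existsNP[Q' /not_implyP[pQ' /not_implyP[PQ' /not_implyP[Q'x]]]].
move=> /not_implyP[Q'Q nQQ'].
have [|P' [pP' PP' P'x P'Q' P'min]] := IHn Q' _ pQ' PQ' Q'x.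
  exact: height_le_lower hPQ _ _ _ _.
by exists P'; split=> // z /P'Q'/Q'Q.
Qed.

(* [P'] is minimal over [P + (x)], so its elements are nilpotent modulo
   [P + (x)] after localization at [P']. *)
Lemma minimal_prime_nilpotent P P' (x z : R) :
    noeth R^o -> is_prime P -> is_prime P' -> P' z ->
    (forall P'', is_prime P'' -> (forall y, P y -> P'' y) -> P'' x ->
      (forall y, P'' y -> P' y) -> forall y, P' y -> P'' y) ->
  exists s m, ~ P' s /\ @addm R^o P x (s * z ^+ m).
Proof.
move=> nR pP pP' P'z P'min; have [sP _ _] := pP; have [_ nP'1 _] := pP'.
apply: contrapT => nsm.
(* If the claim fails, [S] misses P + (x). A prime over P + (x) disjoint from [S] lies inside [P'],
   so contains [P'] by minimality, but it misses [z]. *)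
pose S w := exists2 s, ~ P' s & exists m, w = s * z ^+ m.
have [||Q [pQ JQ SQ]] := prime_disjoint nR (submod_addm x sP) (S := S).
- split=> [|_ _ [s nPs [m ->]] [t nPt [l ->]]].
    by exists 1 => //; exists 0%N; rewrite mulr1.
  exists (s * t); first exact: prime_mulN.
  by exists (m + l)%N; rewrite exprD mulrACA.
- by move=> _ [s nPs [m ->]] J; apply: nsm; exists s, m.
apply: (SQ z); first by exists 1 => //; exists 1%N; rewrite mul1r.
apply: (P'min Q) => // [y Py||y Qy]; first exact/JQ/sub_addm.
  by apply: JQ; have := @mem_addm R^o P x 1 sP; rewrite -[x *: 1]/(x * 1) mulr1.
apply: contrapT => nPy; apply: (SQ y) => //.
by exists y => //; exists 0%N; rewrite mulr1.
Qed.

End Primes.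

(** * Complexes of injective modules *)

Section Complexes.
Variable R : comNzRingType.
Implicit Types M : lmodType R.

Local Notation tors a M := (@torsion _ a M).

(** [g] descends to the image of [f], and injectivity of [J] extends it to [B]. *)
Lemma injective_factor (A B J : lmodType R) (f : {linear A -> B})
    (g : {linear A -> J}) :
    injective_module J -> (forall u, f u = 0 -> g u = 0) ->
  exists h : {linear B -> J}, forall u, h (f u) = g u.
Proof.
move=> injJ fg.
have imE (y : submodule (imm f)) : exists x, val y = f x.
  by apply/asboolP/(valP y).
have [s sE] := choice imE.
have fgE u v : f u = f v -> g u = g v.
  move=> fuv; apply/eqP; rewrite -subr_eq0 -linearB; apply/eqP/fg.
  by rewrite linearB fuv subrr.
have gs_lin : linear (fun y => g (s y)).
  by move=> c x y; rewrite -linearP; apply: fgE; rewrite linearP -!sE linearP.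
pose gsB :=
  GRing.isLinear.Build R (submodule (imm f)) J _ (fun y => g (s y)) gs_lin.
pose gs : {linear submodule (imm f) -> J} := HB.pack (fun y => g (s y)) gsB.
have [h hE] := injJ _ _ (val : submodule (imm f) -> B) gs val_inj.
exists h => u; have fu : f u \in imm f by apply/asboolP; exists u.
rewrite -[f u]/(val (exist _ (f u) fu : submodule (imm f))) hE.
by apply: fgE; rewrite -sE.
Qed.

Lemma injective_prod (J K : lmodType R) :
  injective_module J -> injective_module K -> injective_module (J * K)%type.
Proof.
move=> injJ injK A B f g injf.
have [h1 h1E] := injJ A B f (fst \o g)%FUN injf.
have [h2 h2E] := injK A B f (snd \o g)%FUN injf.
have h_lin : linear (fun x => (h1 x, h2 x)).
  by move=> c x y; rewrite !linearP.
pose hB :=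
  GRing.isLinear.Build R B (J * K)%type _ (fun x => (h1 x, h2 x)) h_lin.
pose h : {linear B -> (J * K)%type} := HB.pack (fun x => (h1 x, h2 x)) hB.
exists h => x; rewrite -[h _]/(h1 _, h2 _).
by rewrite h1E h2E /=; case: (g x).
Qed.

Section Torsion.
Variable a : ideal R.

Lemma torsionZ M c (u : M) : u \in tors a M -> c *: u \in tors a M.
Proof. exact: (@rpredZ R M (tors a M) c u). Qed.

Lemma torsion_map M M' (f : {linear M -> M'}) u :
  u \in tors a M -> f u \in tors a M'.
Proof.
move=> /asboolP[k ku]; apply/asboolP; exists k => c ck.
by rewrite -linearZ /= ku ?linear0.
Qed.

Lemma torsion_pair M M' (u : M) (v : M') :
  (u, v) \in tors a (M * M')%type <->
  u \in tors a M /\ v \in tors a M'.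
Proof.
split=> [uv|[/asboolP[j ju] /asboolP[k kv]]].
  by split; [apply: (torsion_map fst uv)|apply: (torsion_map snd uv)].
apply/asboolP; exists (maxn j k) => c cjk.
congr (_, _); first by apply: ju; apply: ideal_pow_decr cjk; rewrite leq_maxl.
by apply: kv; apply: ideal_pow_decr cjk; rewrite leq_maxr.
Qed.

End Torsion.

(** * Boundaries, and complexes with a single cohomology module *)

Section Boundaries.
Variables (I : nat -> lmodType R) (d : forall i, {linear I i -> I i.+1}).

Definition bnd i : I i -> Prop :=
  match i return I i -> Prop with
  | 0 => fun v => v = 0
  | j.+1 => fun v => exists w, v = d j w
  end.

Lemma submod_bnd i : submod (@bnd i).
Proof.
case: i => [|i] /=.
  by split=> [|x y -> ->|c x ->]; rewrite ?addr0 ?scaler0.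
split=> [|_ _ [u ->] [v ->]|c _ [u ->]].
- by exists 0; rewrite linear0.
- by exists (u + v); rewrite linearD.
- by exists (c *: u); rewrite linearZ.
Qed.

(* Boundaries in the complex of [a]-torsion submodules. *)
Definition tbnd (a : ideal R) i : I i -> Prop :=
  match i return I i -> Prop with
  | 0 => fun v => v = 0
  | j.+1 => fun v => exists2 w, w \in tors a (I j) & v = d j w
  end.

Lemma submod_tbnd a i : submod (@tbnd a i).
Proof.
case: i => [|i] /=.
  by split=> [|x y -> ->|c x ->]; rewrite ?addr0 ?scaler0.
split=> [|_ _ [u uT ->] [v vT ->]|c _ [u uT ->]].
- by exists 0; rewrite ?linear0 ?rpred0.
- by exists (u + v); rewrite ?linearD ?rpredD.
- by exists (c *: u); rewrite ?linearZ ?torsionZ.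
Qed.

Lemma tbnd_bnd a i u : @tbnd a i u -> bnd u.
Proof. by case: i u => [|i] u //= [w _ ->]; exists w. Qed.

(* [r] annihilates the [i]-th cohomology of the complex of [a]-torsion
   submodules. *)
Definition tkill (a : ideal R) (r : R) i : Prop :=
  forall u, u \in tors a (I i) -> d i u = 0 -> tbnd a (r *: u).

Definition resolves (N : lmodType R) e (iota : {linear N -> I e})
    (L : N -> Prop) : Prop :=
  [/\ forall y, d e (iota y) = 0,
      forall y, bnd (iota y) <-> L y,
      forall u, d e u = 0 -> exists y w, bnd w /\ u = iota y + w
    & forall j u, j <> e -> d j u = 0 -> bnd u].

End Boundaries.

(** * The cone of multiplication by [x] *)

Section Cone.
Variables (I : nat -> lmodType R) (d : forall i, {linear I i -> I i.+1}).
Variable x : R.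

(** The cone is shifted so that degree i is the sum of I^i and I^(i-1); in degree 0 the second
    summand is absent, hence a separate first differential. *)
Definition cone_obj i : lmodType R :=
  match i with 0 => I 0 | j.+1 => (I j.+1 * I j)%type end.

Definition cone_d0 (u : I 0) : I 1 * I 0 := (d 0 u, x *: u).

Fact cone_d0_linear : linear cone_d0.
Proof.
by move=> c u v; rewrite /cone_d0 !linearP.
Qed.
HB.instance Definition _ := GRing.isLinear.Build R _ _ _ cone_d0 cone_d0_linear.

Definition cone_dS j (u : I j.+1 * I j) : I j.+2 * I j.+1 :=
  (d j.+1 u.1, x *: u.1 - d j u.2).

Fact cone_dS_linear j : linear (@cone_dS j).
Proof.
move=> c u v; rewrite /cone_dS /= !linearP addrACA -scalerDr.
by [].
Qed.
HB.instance Definition _ j := GRing.isLinear.Build R _ _ _ _ (@cone_dS_linear j).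

Definition cone_d i : {linear cone_obj i -> cone_obj i.+1} :=
  match i return {linear cone_obj i -> cone_obj i.+1} with
  | 0 => cone_d0
  | j.+1 => @cone_dS j
  end.


(** The differential of the second component enters as the boundary [b], which is 0 in degree 0;
    this gives one formula for all degrees. *)
Lemma cone_bnd i (u : I i.+1) (v : I i) :
  bnd cone_d (i := i.+1) (u, v) <->
  exists w b, [/\ bnd d b, u = d i w & v = x *: w - b].
Proof.
case: i u v => [|i] u v; split.
- by case=> w [-> ->]; exists w, 0; rewrite subr0.
- by move=> [w [_ [-> -> ->]]]; exists w; rewrite subr0.
- by case=> -[w w'] [-> ->]; exists w, (d i w'); split=> //; exists w'.
- by move=> [w [_ [[w' ->] -> ->]]]; exists (w, w').
Qed.

Lemma cone_tbnd a i (u : I i.+1) (v : I i) :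
  tbnd cone_d a (i := i.+1) (u, v) <->
  exists w b, [/\ w \in tors a (I i), tbnd d a b, u = d i w & v = x *: w - b].
Proof.
case: i u v => [|i] u v; split.
- by case=> w wT [-> ->]; exists w, 0; rewrite subr0.
- by move=> [w [_ [wT -> -> ->]]]; exists w; rewrite ?subr0.
- case=> -[w w'] /torsion_pair[wT w'T] [-> ->]; exists w, (d i w').
  by split=> //; exists w'.
- move=> [w [_ [wT [w' w'T ->] -> ->]]]; exists (w, w') => //.
  exact/torsion_pair.
Qed.

Hypothesis dd : forall i u, d i.+1 (d i u) = 0.

Lemma cone_dd i u : cone_d i.+1 (cone_d i u) = 0.
Proof.
case: i u => [|i] u /=; rewrite /cone_dS /= dd.
  by rewrite linearZ subrr.
by rewrite linearB linearZ /= dd subr0 subrr.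
Qed.

Lemma cone_cocycle i (u : I i.+1) (v : I i) :
  cone_d i.+1 (u, v) = 0 -> d i.+1 u = 0 /\ d i v = x *: u.
Proof. by case=> -> /eqP; rewrite subr_eq0 => /eqP. Qed.

(* From the exact sequence [H^i -> H^(i+1)(cone) -> H^(i+1)] for torsion
   submodules. *)
Lemma cone_tkill a r i :
  tkill d a 1 i -> tkill d a r i.+1 -> tkill cone_d a r i.+1.
Proof.
move=> k1 kr [u v] /torsion_pair[uT vT] /cone_cocycle[du dv].
have [w wT uE] := kr u uT du.
(* As r u = d w, this element is a torsion cocycle, hence a torsion boundary by [k1]. *)
have wvT : x *: w - r *: v \in tors a (I i) by rewrite rpredB // torsionZ.
have := k1 _ wvT; rewrite scale1r => bT; apply/cone_tbnd.
exists w, (x *: w - r *: v); split=> //; last by rewrite subKr.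
by apply: bT; rewrite linearB !linearZ /= dv -uE scalerN (scaler_swap x) subrr.
Qed.

Lemma cone_tkill0 a r : tkill d a r 0 -> tkill cone_d a r 0.
Proof. by move=> kr u uT [du _]; apply: kr. Qed.

Variables (N : lmodType R) (e : nat) (iota : {linear N -> I e}).
Variable L : N -> Prop.

Definition cone_iota (y : N) : I e.+1 * I e := (0, iota y).

Fact cone_iota_linear : linear cone_iota.
Proof.
move=> c y z; rewrite /cone_iota linearP.
by congr (_, _); rewrite /= scaler0 addr0.
Qed.
HB.instance Definition _ :=
  GRing.isLinear.Build R _ _ _ cone_iota cone_iota_linear.

(** By the long exact sequence: [x] is injective on the cohomology of [d], which is N/L in degree
    [e] and 0 elsewhere, so only its cokernel survives, one degree higher. *)
Lemma cone_resolves :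
    submod L -> (forall y, L (x *: y) -> L y) -> resolves d iota L ->
  resolves cone_d (cone_iota : {linear N -> cone_obj e.+1}) (addm L x).
Proof.
move=> sL regx [iota0 iotaB iotaS dex]; have [L0 LD LZ] := sL.
have [bnd0 bndD bndZ] := submod_bnd d e.
have bx j u : d j u = 0 -> bnd d (x *: u) -> bnd d u.
  have [je|je] := pselect (j = e); last by move=> /(dex j u je).
  move: u; rewrite je => u /iotaS[y [w [wb ->]]]; rewrite scalerDr => xb.
  apply: bndD => //; apply/iotaB/regx/iotaB; rewrite linearZ /=.
  by apply: submod_cancel (submod_bnd d e) xb _; apply: bndZ.
split.
- by move=> y; rewrite /= /cone_dS /= iota0 linear0 scaler0 subrr.
- move=> y; split=> [/cone_bnd[w [b [bb /esym dw yE]]]|[l [v [Ll ->]]]].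
    have [y' [w' [bw' wE]]] := iotaS w dw.
    exists (y - x *: y'), y'; rewrite subrK; split=> //; apply/iotaB.
    rewrite linearB linearZ /= yE wE scalerDr addrAC [_ + x *: w']addrC addrK.
    by apply: submodB => //; apply: bndZ.
  apply/cone_bnd; exists (iota v), (- iota l).
  rewrite iota0 opprK linearD linearZ.
  split=> //; last by rewrite addrC.
  by rewrite -scaleN1r; apply/bndZ/iotaB.
- move=> [u v] /cone_cocycle[du dv].
  have [|w uE] := dex _ u _ du; first by move=> /eqP; rewrite eqn_leq ltnn.
  have [|y [b [bb vE]]] := iotaS (v - x *: w).
    by rewrite linearB linearZ /= dv uE subrr.
  exists y, (u, x *: w + b); split.
    apply/cone_bnd; exists w, (- b); rewrite opprK; split=> //.
    by rewrite -scaleN1r; apply/bndZ.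
  congr (_, _); first by rewrite /= add0r.
  by rewrite /= addrCA -vE addrC subrK.
case=> [u _ [du xu]|j [u v] je /cone_cocycle[du dv]].
  by apply: (bx 0%N) => //; rewrite xu.
(* Injectivity of [x] on cohomology gives u = d w; then [x *: w - v] is a cocycle in a degree other
   than [e], hence a boundary. *)
have [w uE] : bnd d u by apply: bx; rewrite -?dv //; exists v.
apply/cone_bnd; exists w, (x *: w - v); split=> //; last by rewrite subKr.
apply: dex => [je'|]; first by apply: je; rewrite je'.
by rewrite linearB linearZ /= dv uE subrr.
Qed.

Hypothesis injI : forall i, injective_module (I i).

Lemma cone_injective i : injective_module (cone_obj i).
Proof. by case: i => [|i] //=; apply: injective_prod. Qed.

End Cone.

(** * Splitting below the degree of the cohomology *)

Section Vanishing.
Variables (I : nat -> lmodType R) (d : forall i, {linear I i -> I i.+1}).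
Hypothesis injI : forall i, injective_module (I i).
Hypothesis dd : forall i u, d i.+1 (d i u) = 0.

Lemma bnd_cocycle i (u : I i) : bnd d u -> d i u = 0.
Proof.
by case: i u => [|i] u /=; [move=> ->; rewrite linear0|case=> w ->; rewrite dd].
Qed.

(** Exactness below degree [e] and injectivity split the complex there: the boundaries are a direct
    summand of each term up to degree [e]. *)
Lemma bnd_retract e i : (i <= e)%N ->
    (forall j u, (j < e)%N -> d j u = 0 -> bnd d u) ->
  exists rho : {linear I i -> I i},
    (forall v, bnd d (rho v)) /\ forall v, bnd d v -> rho v = v.
Proof.
move=> ie dex; elim: i ie => [_|i IHi ie].
  by exists \0; split=> // v ->.
have [rho [rhoB rhoE]] := IHi (ltnW ie).
(* [g] vanishes on cocycles, which are boundaries here, so g = h d; then d h is the next projection,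
   because d kills the image of [rho]. *)
pose g : {linear I i -> I i} := idfun \- rho.
have [u du|h hE] := injective_factor (f := d i) (g := g) (@injI i).
  by rewrite /= rhoE ?subrr //; apply: dex du.
exists (d i \o h)%FUN; split=> [v|_ [w ->]] /=; first by exists (h v).
by rewrite hE /= linearB (bnd_cocycle (rhoB _)) subr0.
Qed.

(** The a-torsion of N/L embeds in the degree [e] cohomology of the torsion complex: subtracting
    from [iota y] its projection to the boundaries gives a torsion cocycle. *)
Lemma tkill_torsion a r (N : lmodType R) e (iota : {linear N -> I e})
    (L : N -> Prop) y :
    resolves d iota L -> tkill d a r e ->
    (exists k, forall c, c \in ideal_pow a k -> L (c *: y)) -> L (r *: y).
Proof.
move=> [iota0 iotaB _ dex] kr [k ky].
have [|rho [rhoB rhoE]] := bnd_retract (leqnn e) (e := e).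
  by move=> j u je; apply: dex => jE; rewrite jE ltnn in je.
have vT : iota y - rho (iota y) \in tors a (I e).
  apply/asboolP; exists k => c /ky/iotaB cB.
  by rewrite scalerBr -!linearZ /= rhoE ?subrr.
have := kr _ vT; rewrite linearB iota0 (bnd_cocycle (rhoB _)) subr0.
move=> /(_ erefl)/tbnd_bnd; rewrite scalerBr => rB.
apply/iotaB; rewrite linearZ /=.
have [_ bndD bndZ] := submod_bnd d e.
by rewrite -[_ *: _](subrK (r *: rho (iota y))); apply: bndD rB (bndZ _ _ _).
Qed.

End Vanishing.
End Complexes.

(** * The induction *)

Section Induction.
Variable R : comNzRingType.
Hypothesis nR : noeth R^o.
Variable a : ideal R.
Implicit Types P Q : R^o -> Prop.

Lemma ideal_pow1 c : c \in ideal_pow a 1 -> c \in a.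
Proof.
move=> /asboolP[k [b [y [ba _ ->]]]]; apply: rpred_sum => i _.
by rewrite -[_ *: _]/(b i * y i) mulrC; apply: (@rpredZ R R^o a (y i) _ (ba i)).
Qed.

Lemma mem_ideal_pow c k : c \in a -> c ^+ k \in ideal_pow a k.
Proof.
move=> ca; elim: k => // k IHk; apply/asboolP.
exists 1%N, (fun=> c), (fun=> c ^+ k); split=> //.
by rewrite big_ord1 exprS.
Qed.

(** Let C_k = (J : a^k) be maximal among these ideals. If it were proper, an associated prime of
    R/C_k, the annihilator of the class of some b, would contain [a]; then b is in C_(k+1) = C_k, a
    contradiction. *)
Lemma ideal_pow_sub_radical (J : R^o -> Prop) :
    submod J -> (forall c, c \in a -> exists m, J (c ^+ m)) ->
  exists k, forall c, c \in ideal_pow a k -> J c.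
Proof.
move=> sJ aJ; have [J0 JD JZ] := sJ.
pose C k (r : R^o) := forall c, c \in ideal_pow a k -> J (c * r).
have sC k : submod (C k).
  split=> [|x y xC yC|b x xC] c ck; first by rewrite mulr0.
    by rewrite mulrDr; apply: JD; [apply: xC|apply: yC].
  by rewrite -[b *: x]/(b * x) mulrCA; apply: JZ; apply: xC.
have CS k r : (forall c, c \in a -> C k (c * r)) -> C k.+1 r.
  move=> kr _ /asboolP[l [b [y [ba yk ->]]]].
  rewrite mulr_suml; apply: submod_sum => // i.
  by rewrite -[_ *: _]/(b i * y i) (mulrC (b i)) -mulrA; apply: kr.
have [||_ [k ->] kmax] :=
    noeth_max (F := fun I => exists k, I = C k) (L0 := C 0%N) nR.
- by move=> _ [k ->].
- by exists 0%N.
have CSk r : C k.+1 r -> C k r.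
  apply: kmax; first by exists k.+1.
  by move=> s ks; apply: CS => c _; have [_ _ sZ] := sC k; apply: (sZ c s).
exists k => c ck; rewrite -[c]mulr1; apply: contrapT => n1.
have [|b [pb _]] := assoc_prime nR (sC k) (mult_set1 R) (y := 1).
  move=> _ -> C1; apply: n1.
  by have := C1 c ck; rewrite -[_ *: _]/(1 * 1) mul1r.
have [_ nb1 _] := pb; apply: nb1; rewrite /ann scale1r.
apply: CSk; apply: CS => z za; have [m zm] := aJ z za.
apply: (prime_exp (m := m) pb) => d _.
by rewrite -[_ *: _]/(z ^+ m * (b * 1)) mulrCA mulrC; apply: (JZ _ (z ^+ m)).
Qed.

Lemma exprD_mod (u x v : R) l : exists w, (u + x * v) ^+ l = u ^+ l + x * w.
Proof.
elim: l => [|l [w IHl]]; first by exists 0; rewrite !expr0 mulr0 addr0.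
by exists (u * w + v * u ^+ l + x * v * w); rewrite !exprS IHl; ring.
Qed.

Section Module.
Variable N : lmodType R.
Hypothesis nN : noeth N.
Variable r : R.

(** The hypothesis gives a denominator for each [z]; an [s] outside [P] with [ann L (s *: y)]
    maximal works for all of them. *)
Lemma nilpotent_denominator P (L : N -> Prop) y :
    is_prime P -> submod L ->
    (forall z, P z -> exists s m, ~ P s /\ L (s *: (z ^+ m *: y))) ->
  exists2 s, ~ P s & forall z, P z -> exists m, L (z ^+ m *: (s *: y)).
Proof.
move=> pP sL Py; have [_ nP1 _] := pP.
pose F I := exists2 s, I = ann L (s *: y) & ~ P s.
have [||_ [s -> nPs] smax] := noeth_max (F := F) (L0 := ann L (1 *: y)) nR.
- by move=> _ [s -> _]; apply: submod_ann.
- by exists 1.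
exists s => // z Pz; have [t [m [nPt Lt]]] := Py z Pz; exists m.
apply: (smax (ann L ((t * s) *: y))).
- by exists (t * s) => //; apply: prime_mulN.
- by move=> c; rewrite -scalerA; apply: ann_scale.
rewrite /ann (mulrC t) -scalerA scaler_swap (scaler_swap _ t).
by case: sL => _ _; apply.
Qed.

(** As N/L sits in degree [e], degree e + n of the torsion complex computes H^n_a(N/L). The last
    hypothesis says that the image of [y] in the localization of N/L at [P] is P-torsion. *)
Lemma tkill_localized n (I : nat -> lmodType R)
    (d : forall i, {linear I i -> I i.+1}) e (iota : {linear N -> I e})
    (L : N -> Prop) P Q y :
    (forall i, injective_module (I i)) ->
    (forall i u, d i.+1 (d i u) = 0) ->
    submod L -> resolves d iota L ->
    (forall j, (j < e + n)%N -> tkill d a 1 j) -> tkill d a r (e + n) ->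
    is_prime P -> is_prime Q -> (forall z, P z -> Q z) ->
    (forall c, c \in a -> Q c) -> height_le n P Q ->
    (forall z, P z -> exists s m, ~ P s /\ L (s *: (z ^+ m *: y))) ->
  exists2 s, ~ P s & L (s *: (r *: y)).
Proof.
elim: n I d e iota L P y => [|n IHn] I d e iota L P y injI dd sL resI k1 kr
  pP pQ PQ aQ hPQ /(nilpotent_denominator pP sL)[s0 nPs0 Py];
  have [L0 LD LZ] := sL.
  rewrite addn0 in kr.
  (* For n = 0, [a] lies in [Q], hence in [P], so a power of [a] sends [s0 *: y] into [L]. *)
  have [|k ak] := ideal_pow_sub_radical (submod_ann (s0 *: y) sL).
    by move=> c /aQ/hPQ/Py.
  exists s0 => //; rewrite scaler_swap.
  by apply: (tkill_torsion injI dd resI kr); exists k.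
rewrite addnS in k1 kr.
(* H^0_a(N/L) = 0 by [k1], so no nonzero element of N/L is killed by [a]. *)
have [x xa regx] : exists2 x, x \in a & forall v, L (x *: v) -> L v.
  apply: (regular_element nR nN sL (submod_pred a)) => v av.
  rewrite -[v]scale1r; apply: (tkill_torsion injI dd resI (k1 e _)).
    by rewrite ltnS leq_addr.
  by exists 1%N => c /ideal_pow1/av.
have regX k v : L (x ^+ k *: v) -> L v.
  by elim: k => [|k IHk]; rewrite ?scale1r // exprS -scalerA => /regx/IHk.
have [Ly|nLy] := pselect (L (s0 *: y)).
  by exists s0 => //; rewrite scaler_swap; apply: LZ.
have nPx : ~ P x by move=> /Py[m /regX].
have [P' [pP' PP' P'x P'Q P'min]] := minimal_prime hPQ pQ PQ (aQ x xa).
have hP'Q : height_le n P' Q by apply: hPQ => // P'P; apply/nPx/P'P.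
have [|s nP's Ls] :=
    @krull_intersection _ _ L P' x (r *: (s0 *: y)) nN sL pP' P'x.
  move=> k; apply: (IHn _ (cone_d d (x ^+ k)) e.+1
    (cone_iota iota : {linear N -> cone_obj I e.+1}) _ P' (s0 *: y)) => //.
  - exact: cone_injective.
  - exact: cone_dd.
  - exact: submod_addm.
  - by apply: cone_resolves => //; apply: regX.
  - case=> [|j] jn; first by apply: cone_tkill0; apply: k1.
    by apply: cone_tkill => //; apply: k1 => //; apply: ltnW.
  - by apply: cone_tkill => //; apply: k1.
  (* [P'] is also minimal over P + (x^k), so s z^m = u + x^k v with [u] in [P]. Some u^l sends
     [s0 *: y] into [L], so (s z^m)^l sends it into L + x^k N. *)
  move=> z P'z.
  have [|s [m [nP's [u [v [Pu zE]]]]]] :=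
      minimal_prime_nilpotent (x := x ^+ k) nR pP pP' P'z.
    by move=> P'' pP'' PP'' /(prime_exp pP''); apply: P'min.
  have [l Lu] := Py u Pu; exists (s ^+ l), (m * l)%N; split.
    by move=> /(prime_exp pP').
  rewrite exprM [_ *: (_ *: (s0 *: y))]scalerA -exprMn zE.
  have [w ->] := exprD_mod u (x ^+ k) v l.
  rewrite scalerDl -scalerA; exists (u ^+ l *: (s0 *: y)), (w *: (s0 *: y)).
  by [].
exists (s * s0).
  by apply: prime_mulN => // /PP'.
by rewrite -scalerA (scaler_swap s0).
Qed.

End Module.
End Induction.

(** * Heights *)

Section PrimeIdeals.
Variable R : comNzRingType.
Implicit Types (P : R^o -> Prop) (p : prime_idealr R).

Lemma is_prime_idealr p : @is_prime R (fun x => x \in p).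
Proof.
split; first split=> [|x y|c x]; rewrite ?rpred0 ?idealr1 //.
- exact: rpredD.
- exact: idealMr.
- by move=> x y; rewrite prime_idealrM => /orP.
Qed.

Lemma prime_idealr_exists P :
  is_prime P -> exists p : prime_idealr R, forall x, x \in p <-> P x.
Proof.
move=> [[P0 PD PZ] nP1 PM]; pose S : {pred R} := fun x => `[< P x >].
have idS : idealr_closed S.
  split; [exact/asboolP|by apply/asboolP|].
  by move=> c x y /asboolP Px /asboolP Py; apply/asboolP/PD/Py/(PZ c).
have pS : prime_idealr_closed S.
  by move=> x y /asboolP/PM[] ?; apply/orP; [left|right]; apply/asboolP.
pose B1 := isIdealr.Build R S idS.
pose B2 := isPrimeIdealrClosed.Build R S pS.
pose p : prime_idealr R := HB.pack S B1 B2.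
by exists p => x; split=> [/asboolP|Px]; last exact/asboolP.
Qed.

End PrimeIdeals.

Section Heights.

Lemma enat_inf_some (P : set nat) n :
  enat_inf P = Some n -> P n /\ forall m, P m -> (n <= m)%N.
Proof.
rewrite /enat_inf; case: pselect => // exP [<-].
case: ex_minnP => m /asboolP Pm mP; split=> // k Pk.
by apply: mP; apply/asboolP.
Qed.

Variables (R : comNzRingType) (p : prime_idealr R).
Local Notation A := {ideal_quot p}.
Local Notation pi := (\pi_A : R -> A).

Lemma pi_repr (P : R^o -> Prop) x : is_prime P -> (forall z, z \in p -> P z) ->
  P (repr (pi x)) <-> P x.
Proof.
move=> [sP _ _] pP; have px : repr (pi x) - x \in p.
  by rewrite Quotient.idealrBE reprK.
split=> Px.
  rewrite -[x](subKr (repr (pi x))); apply: (submodB (M := R^o) sP) => //.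
  exact: pP.
rewrite -(subrK x (repr (pi x))); case: sP => _ PD _.
by apply: PD => //; apply: pP.
Qed.

Lemma quot_prime (P : R^o -> Prop) : is_prime P -> (forall z, z \in p -> P z) ->
  exists q : prime_idealr A, forall x, pi x \in q <-> P x.
Proof.
move=> pP sub; have [[P0 PD PZ] nP1 PM] := pP.
have PE x := pi_repr x pP sub.
have [|q qE] := @prime_idealr_exists A (fun y => P (repr y)).
  split; first split=> [|x y|c x].
  - by rewrite -(rmorph0 pi); apply/PE.
  - rewrite -[x]reprK -[y]reprK -(rmorphD pi) !PE; exact: PD.
  - rewrite -[x]reprK -[c]reprK -[_ *: _]/(_ * _) -(rmorphM pi) !PE; exact: PZ.
  - by rewrite -(rmorph1 pi) PE.
  - move=> x y; rewrite -[x]reprK -[y]reprK -(rmorphM pi) !PE; exact: PM.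
by exists q => x; rewrite qE PE.
Qed.

Variable q : prime_idealr A.

(** Unfolding the failure of [height_le n] gives n + 1 strict inclusions, pushed down to R/p; the
    condition on [c 0] lets the induction prepend a prime. *)
Lemma chain_of_not_height_le n (P : R^o -> Prop) :
    is_prime P -> (forall z, z \in p -> P z) -> (forall z, P z -> pi z \in q) ->
    ~ height_le n P (fun z => pi z \in q) ->
  exists c : nat -> prime_idealr A,
    [/\ forall i, (i < n.+1)%N ->
          {subset c i <= c i.+1} /\ ~ {subset c i.+1 <= c i},
        c n.+1 =i q & forall x, pi x \in c 0%N <-> P x].
Proof.
elim: n P => [|n IHn] P pP sub Pq nh; have [q0 q0E] := quot_prime pP sub.
  exists (fun i => if i is 0 then q0 else q); split=> // -[|//] _; split=> [y|].
    by rewrite -[y]reprK => /q0E/Pq.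
  by move=> sq; apply: nh => x /sq/q0E.
apply: contrapT => nc; apply: nh => P' pP' PP' nP'P P'q; apply: contrapT => nh.
have [|c [cS cq c0]] := IHn P' pP' _ P'q nh; first by move=> z /sub/PP'.
apply: nc; exists (fun i => if i is j.+1 then c j else q0); split=> //.
case=> [|i] //= ic; last by apply: cS.
split=> [y|sq]; first by rewrite -[y]reprK => /q0E/PP'/c0.
by apply: nP'P => x /c0/sq/q0E.
Qed.

Lemma height_le_prime_height n : prime_height q = Some n ->
  height_le n (fun z => z \in p) (fun z => pi z \in q).
Proof.
move=> hq; apply: contrapT => /(chain_of_not_height_le (is_prime_idealr p)).
case=> // [z zp|c [cS cq _]].
  rewrite (_ : pi z = 0) ?rpred0 //; apply/eqP.
  by rewrite -(rmorph0 pi) -Quotient.idealrBE subr0.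
have [/(_ n.+1)] := enat_inf_some hq; rewrite /mkset ltnn => h _.
by suff : false by []; apply: h; exists c.
Qed.

End Heights.

(** The infimum defining the height is attained at a prime of R/p; [Q] is its preimage in [R]. *)
Lemma height_mod_prime (R : comNzRingType) (a : ideal R)
    (p : prime_idealr R) n :
    height_mod a p = Some n ->
  exists Q : R^o -> Prop, [/\ is_prime Q, forall z, z \in p -> Q z,
    forall c, c \in a -> Q c & height_le n (fun z => z \in p) Q].
Proof.
move=> /enat_inf_some[[q Iq hq] _].
exists (fun z => \pi_({ideal_quot p}) z \in q).
have aq u v : u \in a -> v \in p -> \pi_({ideal_quot p}) (u + v) \in q.
  by move=> ua vp; apply: Iq; exists (u + v) => //; exists u, v.
split=> [|z zp|c ca|]; last exact: height_le_prime_height.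
- have [[q0 qD qZ] nq1 qM] := is_prime_idealr q.
  split; first split=> [|x y|c x].
  + by rewrite rmorph0.
  + by rewrite rmorphD; apply: qD.
  + by rewrite -[_ *: _]/(_ * _) rmorphM; apply: qZ.
  + by rewrite rmorph1.
  + by move=> x y; rewrite rmorphM; apply: qM.
- by rewrite -[z]add0r; apply: aq; rewrite ?rpred0.
- by rewrite -[c]addr0; apply: aq; rewrite ?rpred0.
Qed.

(** * Local cohomology *)

Section Cohomology.
Variable R : comNzRingType.

Lemma Ann_quotient (M : lmodType R) (L : submodClosed M) r :
  Ann (quotient_module L) r <-> forall x, r *: x \in L.
Proof.
have piE x : (\pi_(Quotient.quot (submod_zpred L)) x == 0) = (x \in L).
  rewrite -(raddf0 (\pi_(Quotient.quot (submod_zpred L)))).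
  by rewrite -Quotient.idealrBE subr0.
split=> [rL x|rL x].
  rewrite -piE -quotient_scaleE; apply/eqP.
  exact: (rL (\pi_(Quotient.quot (submod_zpred L)) x)).
rewrite -[x](@reprK _ (Quotient.quot (submod_zpred L))).
by apply/eqP; rewrite -[_ *: _]/(quotient_scale _ _) quotient_scaleE piE.
Qed.

Variables (a : ideal R) (N : lmodType R) (E : injective_resolution N).

Lemma coboundaries_tbnd i (w : Gamma a (E i)) :
  w \in coboundaries (fun j => Gamma_map (a := a) (ires_d E j)) i <->
  tbnd (ires_d E) a (val w).
Proof.
case: i w => [|i] w; first by split=> [/eqP-> //|w0]; apply/eqP/val_inj.
split=> [/asboolP[v ->]|[v vT wE]].
  by exists (val v) => //; apply: (valP v).
by apply/asboolP; exists (exist _ v vT); apply: val_inj.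
Qed.

Lemma Ann_local_cohomology r i :
  Ann (local_cohomology a E i) r <-> tkill (ires_d E) a r i.
Proof.
apply: (iff_trans (Ann_quotient _ _)); split=> [rH u uT du|rH u].
  pose v : Gamma a (E i) := exist _ u uT.
  have vZ : v \in cocycles (fun j => Gamma_map (a := a) (ires_d E j)) i.
    by apply/eqP/val_inj.
  exact: (coboundaries_tbnd (r *: v)).1 (rH (exist _ v vZ)).
have du : ires_d E i (val (val u)) = 0 by have /eqP/(congr1 val) := valP u.
rewrite -[_ \in _]/(val (r *: u) \in coboundaries _ _) linearZ.
apply/coboundaries_tbnd; rewrite [X in tbnd _ _ X]linearZ.
exact: rH (valP (val u)) du.
Qed.

Lemma dd_ires i u : ires_d E i.+1 (ires_d E i u) = 0.
Proof.
have : ires_d E i u \in kerm (ires_d E i.+1).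
  by rewrite ires_exact; apply/asboolP; exists u.
by move=> /eqP.
Qed.

Lemma resolves_ires : resolves (ires_d E) (ires_aug E) (fun y => y = 0).
Proof.
have d0 u : ires_d E 0 u = 0 <-> exists y, u = ires_aug E y.
  have := @ires_exact0 _ _ E u; rewrite -[u \in kerm _]/(_ == 0) => uE.
  split=> [/eqP|uy]; first by rewrite uE => /asboolP.
  by apply/eqP; rewrite uE; apply/asboolP.
split=> [y|y|u /d0[y ->]|[|j] u // _ du].
- by apply/d0; exists y.
- split=> [|->]; last by rewrite /= linear0.
  by rewrite /= => /eqP; rewrite -(linear0 (ires_aug E)) => /eqP/ires_aug_inj.
- by exists y, 0; rewrite addr0.
have : u \in kerm (ires_d E j.+1) by apply/eqP.
by rewrite ires_exact => /asboolP.
Qed.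

(* Multiplication by [r] lifts the zero endomorphism of [N], so it is
   null-homotopic: [r = sigma + h d], where [sigma] factors through [d]. *)
Lemma tkill_annihilator r i :
  (forall y : N, r *: y = 0) -> tkill (ires_d E) a r i.
Proof.
move=> rN; have [_ _ iotaS dex] := resolves_ires.
suff [sigma [sigmaT _ sigmaE]] : exists sigma : {linear E i -> E i},
    [/\ forall v, v \in @torsion _ a (E i) -> tbnd (ires_d E) a (sigma v),
        forall v, ires_d E i (sigma v) = 0
      & forall v, ires_d E i v = 0 -> r *: v = sigma v].
  by move=> u uT du; rewrite sigmaE //; apply: sigmaT.
elim: i => [|i [sigma [sigmaT dsigma sigmaE]]].
  exists \0; split=> // v; first by rewrite linear0.
  by move=> /iotaS[y [_ [-> ->]]]; rewrite addr0 -linearZ /= rN linear0.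
(* [g] vanishes on cocycles, so g = h d. As d kills the image of [sigma], d h agrees with [r] on
   boundaries, which are all the cocycles in degree i + 1. *)
pose g : {linear E i -> E i} := *:%R r \- sigma.
have [u du|h hE] :=
    injective_factor (f := ires_d E i) (g := g) (@ires_injective _ _ E i).
  by rewrite /= sigmaE ?subrr.
exists (ires_d E i \o h)%FUN; split=> [v vT|v|v dv] /=.
- by exists (h v) => //; apply: torsion_map.
- exact: dd_ires.
have [w ->] : bnd (ires_d E) v by apply: dex.
by rewrite hE /= linearB linearZ dsigma subr0.
Qed.

(** Modulo torsion boundaries, r u = c r u = c^2 r u and so on, while c^k u = 0 for some k. *)
Lemma tkill_localize c r i : c \in a ->
  tkill (ires_d E) a ((1 - c) * r) i -> tkill (ires_d E) a r i.
Proof.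
move=> ca kc u uT du; have /asboolP[k ku] := uT.
have [_ bD _] := submod_tbnd (ires_d E) a i.
suff H l : tbnd (ires_d E) a (r *: u - c ^+ l *: (r *: u)).
  have := H k; rewrite scaler_swap (ku (c ^+ k)) ?mem_ideal_pow //.
  by rewrite scaler0 subr0.
elim: l => [|l IHl].
  by rewrite scale1r subrr; case: (submod_tbnd (ires_d E) a i).
have -> : r *: u - c ^+ l.+1 *: (r *: u) =
    (r *: u - c ^+ l *: (r *: u)) + ((1 - c) * r) *: (c ^+ l *: u).
  rewrite !scalerA -!scalerBl -scalerDl; congr (_ *: _).
  by rewrite exprS; ring.
apply: bD => //; apply: kc; first exact: torsionZ.
by rewrite linearZ /= du scaler0.
Qed.

End Cohomology.

(** * Associated primes of [N] and the submodule S(a, N) *)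

Section AssociatedPrimes.
Variables (R : comNzRingType) (N : lmodType R) (a : ideal R).
Hypotheses (nR : noeth R^o) (nN : noeth N).

Lemma Ass_prime (P : R^o -> Prop) y : is_prime (ann (fun x : N => x = 0) y) ->
  (forall z, ann (fun x : N => x = 0) y z <-> P z) ->
  exists p : prime_idealr R, Ass N p /\ forall x, x \in p <-> P x.
Proof.
move=> /prime_idealr_exists[p pE] PE.
by exists p; split=> [|x]; [exists y|rewrite pE].
Qed.

Lemma submod0 : submod (fun x : N => x = 0).
Proof. by split=> [|x y -> ->|c x ->]; rewrite ?addr0 ?scaler0. Qed.

Lemma loc_kernelE p (x : N) :
  x \in loc_kernel N p <-> exists2 s, s \notin p & s *: x = 0.
Proof.
split=> [/eqP/frac_eqE[u up]|[s sp sx]]; rewrite /=.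
  by rewrite !scale1r scaler0 => ux; exists u.
by apply/eqP/frac_eqP; exists s => //=; rewrite !scale1r sx scaler0.
Qed.

(** Otherwise some associated prime p = Ann(b y) misses 1 + a, so a + p is not R. Then some s
    outside p kills [y], hence kills b y and lies in p, a contradiction. *)
Lemma S_sub_killed y : y \in S_sub a N -> exists2 c, c \in a & (1 - c) *: y = 0.
Proof.
move=> /asboolP Sy; apply: contrapT => nc.
pose S s := exists2 c, c \in a & s = 1 - c.
have [_ aD aZ] := submod_pred a.
have mS : mult_set S.
  split=> [|_ _ [b ba ->] [c ca ->]]; first by exists 0; rewrite ?rpred0 ?subr0.
  exists (b + c - b * c); last by ring.
  exact: submodB (submod_pred a) (aD _ _ ba ca) (aZ b c ca).
have [|b [pb Sb]] := assoc_prime nR submod0 mS (y := y).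
  by move=> _ [c ca ->] cy; apply: nc; exists c.
have [p [Np pE]] := Ass_prime pb (fun z => iff_refl _).
have [|s sp sy] := (loc_kernelE p y).1 (Sy p _).
  split=> // /(congr1 (@^~ 1)) h.
  have [u [v [ua vp uv]]] : ideal_add a p 1 by rewrite h.
  apply: (Sb v); first by exists u => //; rewrite uv addrAC subrr add0r.
  exact/pE.
move: sp => /negP; apply; apply/pE; rewrite /ann.
by rewrite scaler_swap sy scaler0.
Qed.

(** S(a, N) is finitely generated, and a product of elements of 1 - a is again in 1 - a. *)
Lemma S_sub_killed_uniformly : exists2 c, c \in a &
  forall y, y \in S_sub a N -> (1 - c) *: y = 0.
Proof.
have [s [sS Ss]] := nN (submod_pred (S_sub a N)).
have sub c : submod (fun y : N => (1 - c) *: y = 0).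
  split=> [|x y xE yE|b x xE]; first by rewrite scaler0.
    by rewrite scalerDr xE yE addr0.
  by rewrite scaler_swap xE scaler0.
suff [c ca sc] : exists2 c, c \in a & forall y, y \in s -> (1 - c) *: y = 0.
  by exists c => // y /Ss; apply: (span_min (sub c) sc).
elim: s sS {Ss} => [|g s IHs] sS; first by exists 0; rewrite ?rpred0.
have [|c ca sc] := IHs; first by move=> y ys; apply: sS; rewrite inE ys orbT.
have [b ba gb] := S_sub_killed (sS g (mem_head _ _)).
exists (b + c - b * c).
  have [_ aD aZ] := submod_pred a.
  exact: submodB (submod_pred a) (aD _ _ ba ca) (aZ b c ca).
have -> : 1 - (b + c - b * c) = (1 - c) * (1 - b) by ring.
move=> y; rewrite inE => /predU1P[->|/sc yc].
  by rewrite -scalerA gb scaler0.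
by rewrite mulrC -scalerA yc scaler0.
Qed.

(** Otherwise an associated prime misses all s z^m with s outside [p]; it lies inside [p], so
    contains [p] by minimality, yet misses [z]. *)
Lemma MinAss_nilpotent p z (y : N) : MinAss N p -> z \in p ->
  exists s m, ~ s \in p /\ s *: (z ^+ m *: y) = 0.
Proof.
move=> [_ pmin] zp; apply: contrapT => nsm.
have pP := is_prime_idealr p.
pose S w := exists2 s, ~ s \in p & exists m, w = s * z ^+ m.
have mS : mult_set S.
  split=> [|_ _ [s nps [m ->]] [t npt [l ->]]].
    by exists 1; rewrite ?idealr1 //; exists 0%N; rewrite mulr1.
  exists (s * t); first exact: (prime_mulN pP nps npt).
  by exists (m + l)%N; rewrite exprD mulrACA.
have [|b [pb Sb]] := assoc_prime nR submod0 mS (y := y).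
  by move=> _ [s nps [m ->]] sy; apply: nsm; exists s, m; rewrite scalerA.
have [q [Nq qE]] := Ass_prime pb (fun w => iff_refl _).
have qp : {subset q <= p}.
  move=> w /qE wb; apply: contrapT => nw; apply: (Sb w) => //.
  by exists w => //; exists 0%N; rewrite mulr1.
apply: (Sb z).
  by exists 1; rewrite ?idealr1 //; exists 1%N; rewrite mul1r.
by apply/qE/(pmin q Nq qp).
Qed.

End AssociatedPrimes.

Theorem theorem5p4 (R : comNzRingType) (N : lmodType R) (a : ideal R)
    (E : injective_resolution N) (n : nat)
    (noethR : noetherian R) (fgN : fin_gen N)
    (haN : [set` ideal_smul a (topm N)] <> [set: N])
    (hn : depth a E = Some n) :
  let Sigma := fun p => MinAss N p /\ height_mod a p = Some n in
  let Sigma' := fun p => (Ass N p /\ ~ MinAss N p) /\ height_mod a p = Some n in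
  Ann (quotient_module (S_sub a N)) `<=` Ann (local_cohomology a E n) /\
  Ann (local_cohomology a E n) `<=`
    Ann (quotient_module (bigcapm Sigma (loc_kernel N))) `&`
    [set r | forall p, Sigma' p -> r \in p].
Proof.
move=> Sigma Sigma'.
have nR := noeth_ring noethR; have nN := noeth_fin_gen noethR fgN.
split=> r rAnn.
  have [c ca cS] := S_sub_killed_uniformly a nR nN.
  apply/Ann_local_cohomology/(tkill_localize ca)/tkill_annihilator => y.
  by rewrite -scalerA; apply: cS; move/Ann_quotient: rAnn.
have kr : tkill (ires_d E) a r n by apply/Ann_local_cohomology.
have k1 j : (j < n)%N -> tkill (ires_d E) a 1 j.
  move=> jn; apply/Ann_local_cohomology => x; rewrite scale1r.
  apply: contrapT => /eqP x0; have [_ /(_ j)] := enat_inf_some hn.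
  by rewrite leqNgt jn => h; suff : false by []; apply: h; exists x.
(* The induction starts from the resolution [E], with e = 0 and L = 0. *)
have key p (y : N) : height_mod a p = Some n ->
    (forall z, z \in p -> exists s m, ~ s \in p /\ s *: (z ^+ m *: y) = 0) ->
    exists2 s, s \notin p & s *: (r *: y) = 0.
  move=> /height_mod_prime[Q [pQ sub aQ hQ]] yp.
  have [s sp sy] := tkill_localized nR nN
    (@ires_injective _ _ E) (@dd_ires _ _ E)
    (submod0 N) (resolves_ires E) k1 kr (is_prime_idealr p) pQ sub aQ hQ yp.
  by exists s => //; apply/negP.
split=> [|p [[[y yE] _] hp]].
  apply/Ann_quotient => y; apply/asboolP => p [pmin hp]; apply/loc_kernelE.
  by apply: key => // z zp; apply: MinAss_nilpotent.
(* Here [p] is the annihilator of [y], so [y] is p-torsion, and s r y = 0 puts s r, hence r, in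
   [p]. *)
have [|s sp sy] := key p y hp.
  move=> z zp; exists 1, 1%N; rewrite idealr1; split=> //.
  by rewrite scale1r; apply/yE.
have : s * r \in p by apply/yE; rewrite -scalerA.
by rewrite prime_idealrM (negPf sp).
Qed.
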